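(* Let $G$ be a finitely presented group, given with a finite presentation, and let $K_G$ be the corresponding presentation $2$-complex. Then there exist a group $G_e$ with an echelon presentation, with presentation $2$-complex $K_{G_e}$, and a map $f\colon K_{G_e}\to K_G$ such that the induced homomorphism on fundamental groups $\rho=f_\sharp\colon G_e\to G$ is surjective, and the induced homomorphism in cohomology $f^*\colon H^*(K_G;\mathbb{Z})\to H^*(K_{G_e};\mathbb{Z})$ is an isomorphism.
   Context: For a finite presentation $P=\langle x_1,\dots,x_n\mid w_1,\dots,w_m\rangle$ of a group, the presentation $2$-complex has one $0$-cell, one $1$-cell for each generator, and one $2$-cell for each relator, attached along that relator. Let $F$ be the free group on $x_1,\dots,x_n$, and for $w\in F$ let $\varepsilon_i(w)\in\mathbb{Z}$ be the augmentation of the Fox derivative $\partial w/\partial x_i$, i.e. the exponent sum of $x_i$ in $w$. The presentation $P$ is an echelon presentation if the $m\times n$ integer matrix $(\varepsilon_i(w_k))$ (row index $k$, column index $i$) is in row-echelon form. *)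

(* Defs.v *)
From HB Require Import structures.
From mathcomp Require Import all_boot all_order all_algebra.
From mathcomp Require Import generic_quotient ring_quotient.
From mathcomp Require Import all_classical all_reals topology normedtype.
From mathcomp Require Import continuous_path homotopy.
From mathcomp Require Import lra.

Set Implicit Arguments.
Unset Strict Implicit.
Unset Printing Implicit Defensive.

Import Order.TTheory GRing.Theory Num.Theory.
Import numFieldNormedType.Exports.

Local Open Scope classical_set_scope.
Local Open Scope ring_scope.
Local Open Scope quotient_scope.

Section ContinuityTools.

Lemma continuous_ifle (R : realType) (T X : topologicalType) (h k : T -> R)
    (f g : T -> X) :
  continuous h -> continuous k -> continuous f -> continuous g ->
  (forall t, h t = k t -> f t = g t) ->
  continuous (fun t => if h t <= k t then f t else g t).
Proof.
move=> ch ck cf cg fg; apply/continuous_closedP => C cC.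
have ckh : continuous (fun t => k t - h t) by move=> t; apply: cvgB; [exact: ck|exact: ch].
have -> : (fun t => if h t <= k t then f t else g t) @^-1` C =
    ((fun t => k t - h t) @^-1` [set x | 0 <= x] `&` f @^-1` C) `|`
    ((fun t => k t - h t) @^-1` [set x | x <= 0] `&` g @^-1` C).
  apply/seteqP; split=> t /=.
    by rewrite subr_ge0 subr_le0; case: (leP (h t) (k t)) => [?|/ltW ?];
      [left|right].
  rewrite subr_ge0 subr_le0 => -[[-> //]|[kh Cg]].
  case: ifPn => // hk; rewrite fg //; apply/eqP.
  by rewrite eq_le hk kh.
apply: closedU; apply: closedI.
- by apply: preimage_closed => //; exact: closed_ge.
- exact: (continuous_closedP f).1.
- by apply: preimage_closed => //; exact: closed_le.
- exact: (continuous_closedP g).1.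
Qed.

Lemma continuous_pairT (T X Y : topologicalType) (f : T -> X) (g : T -> Y) :
  continuous f -> continuous g -> continuous (fun t => (f t, g t)).
Proof. by move=> cf cg t; apply: cvg_pair; [exact: cf|exact: cg]. Qed.

Lemma continuous_compT (X Y Z : topologicalType) (f : X -> Y) (g : Y -> Z) :
  continuous f -> continuous g -> continuous (fun t => g (f t)).
Proof. by move=> cf cg t; apply: continuous_comp; [exact: cf|exact: cg]. Qed.

Lemma continuous_fstT (X Y : topologicalType) : continuous (@fst X Y).
Proof. by move=> x; exact: cvg_fst. Qed.

Lemma continuous_sndT (X Y : topologicalType) : continuous (@snd X Y).
Proof. by move=> x; exact: cvg_snd. Qed.

End ContinuityTools.

Definition unit_interval (R : realType) : Type := set_type (`[0, 1]%classic : set R).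

Section UnitInterval.
Variable R : realType.
Local Notation I := (unit_interval R).

HB.instance Definition _ := SubType.on I.
HB.instance Definition _ := Topological.on I.

Lemma unit_intervalP (t : I) : 0 <= val t <= 1.
Proof. by case: t => t /= /set_mem /=; rewrite in_itv. Qed.

Lemma clampr_subproof (x : R) : Num.max 0 (Num.min 1 x) \in (`[0, 1]%classic : set R).
Proof.
by rewrite inE /= in_itv /= le_max lexx /= ge_max ge_min lexx ler01.
Qed.

Definition clamp (x : R) : I :=
  exist (fun y => is_true (y \in `[0, 1]%classic)) _ (clampr_subproof x).

Lemma clamp_id (x : R) : 0 <= x <= 1 -> val (clamp x) = x.
Proof. by case/andP=> x0 x1 /=; rewrite min_r // max_r. Qed.

Lemma clampK (t : I) : clamp (val t) = t.
Proof. by apply: val_inj; rewrite clamp_id // unit_intervalP. Qed.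

Lemma unit_interval_01 : clamp 0 != clamp 1.
Proof.
apply/eqP => /(congr1 val); rewrite !clamp_id ?lexx ?ler01 //.
by move=> /eqP; rewrite eq_sym oner_eq0.
Qed.

HB.instance Definition _ := isBiPointed.Build I unit_interval_01.

Lemma val_zero : val (zero : I) = 0.
Proof. by rewrite clamp_id // lexx ler01. Qed.

Lemma val_one : val (one : I) = 1.
Proof. by rewrite clamp_id // lexx ler01. Qed.

Lemma clamp_le0 (x : R) : x <= 0 -> clamp x = zero.
Proof.
move=> x0; apply: val_inj; rewrite val_zero /= min_r ?max_l //.
exact: le_trans x0 _.
Qed.

Lemma clamp_ge1 (x : R) : 1 <= x -> clamp x = one.
Proof. by move=> x1; apply: val_inj; rewrite val_one /= min_l // max_r. Qed.

Lemma continuous_val : continuous (val : I -> R).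
Proof. exact: initial_continuous. Qed.

Lemma continuous_clamp : continuous clamp.
Proof.
apply: continuous_comp_initial => x /=; apply: continuous_max.
  exact: cvg_cst.
by apply: continuous_min; [exact: cvg_cst|exact: cvg_id].
Qed.

End UnitInterval.

Section Concatenation.
Variable R : realType.
Local Notation I := (unit_interval R).

Definition path_cat (T : Type) (f g : I -> T) (t : I) : T :=
  if val t <= 2^-1 then f (clamp (2 * val t)) else g (clamp (2 * val t - 1)).

Definition path_rev (T : Type) (f : I -> T) (t : I) : T := f (clamp (1 - val t)).

Lemma path_cat_comp (T U : Type) (h : T -> U) (f g : I -> T) :
  h \o path_cat f g = path_cat (h \o f) (h \o g).
Proof. by apply/funext => t; rewrite /path_cat /=; case: ifP. Qed.

Lemma path_cat_zero (T : Type) (f g : I -> T) : path_cat f g zero = f zero.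
Proof.
by rewrite /path_cat val_zero mulr0 invr_ge0 ler0n clamp_le0.
Qed.

Lemma path_cat_one (T : Type) (f g : I -> T) : path_cat f g one = g one.
Proof.
rewrite /path_cat val_one ifF; last by apply/negbTE; lra.
by rewrite clamp_ge1 //; lra.
Qed.

Lemma path_rev_zero (T : Type) (f : I -> T) : path_rev f zero = f one.
Proof. by rewrite /path_rev val_zero subr0 clamp_ge1. Qed.

Lemma path_rev_one (T : Type) (f : I -> T) : path_rev f one = f zero.
Proof. by rewrite /path_rev val_one subrr clamp_le0. Qed.

Lemma continuous_lin (T : topologicalType) (h : T -> R) (a b : R) :
  continuous h -> continuous (fun t => a * h t + b).
Proof.
by move=> ch t; apply: cvgD; [apply: cvgMr; exact: ch|exact: cvg_cst].
Qed.

Lemma continuous_affine (T : topologicalType) (h : T -> R) (a b : R) :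
  continuous h -> continuous (fun t => clamp (a * h t + b)).
Proof.
move=> ch; apply: (continuous_compT _ (@continuous_clamp R)).
exact: continuous_lin.
Qed.

Lemma path_cat_continuous_gen (T X : topologicalType) (h : T -> R)
    (f g : T -> I -> X) :
  continuous h -> continuous (fun z : T * I => f z.1 z.2) ->
  continuous (fun z : T * I => g z.1 z.2) ->
  (forall t, f t one = g t zero) ->
  continuous (fun t => if h t <= 2^-1 then f t (clamp (2 * h t))
                       else g t (clamp (2 * h t - 1))).
Proof.
move=> ch cf cg fg; apply: continuous_ifle => //.
- by move=> t; exact: cvg_cst.
- have := @continuous_affine T h 2 0 ch.
  under eq_fun do rewrite addr0.
  move=> c2; have ci : continuous (@idfun T) by move=> t; exact: cvg_id.
  exact: (continuous_compT (continuous_pairT ci c2) cf).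
- have c2 := @continuous_affine T h 2 (-1) ch.
  have ci : continuous (@idfun T) by move=> t; exact: cvg_id.
  exact: (continuous_compT (continuous_pairT ci c2) cg).
- move=> t ->; rewrite clamp_ge1; last by lra.
  by rewrite clamp_le0 //; lra.
Qed.

Lemma path_cat_continuous (X : topologicalType) (f g : I -> X) :
  continuous f -> continuous g -> f one = g zero -> continuous (path_cat f g).
Proof.
move=> cf cg fg; apply: (@path_cat_continuous_gen I X val (fun=> f) (fun=> g)).
- exact: continuous_val.
- exact: (continuous_compT (@continuous_sndT _ _) cf).
- exact: (continuous_compT (@continuous_sndT _ _) cg).
- by [].
Qed.

Lemma path_rev_continuous (X : topologicalType) (f : I -> X) :
  continuous f -> continuous (path_rev f).
Proof.
move=> cf; apply: continuous_compT cf.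
have := @continuous_affine I val (-1) 1 (@continuous_val R).
by under eq_fun do rewrite mulN1r addrC.
Qed.

End Concatenation.

Section Homotopy.
Variables (R : realType) (X : topologicalType).
Local Notation I := (unit_interval R).

Section CatRev.
Variables (x y z : X) (p : {path I from x to y in X})
  (q : {path I from y to z in X}).

Lemma cat_ends : p one = q zero.
Proof. by rewrite path_one path_zero. Qed.

Lemma cat_zero : path_cat p q zero = x.
Proof. by rewrite path_cat_zero path_zero. Qed.

Lemma cat_one : path_cat p q one = z.
Proof. by rewrite path_cat_one path_one. Qed.

Lemma rev_zero : path_rev p zero = y.
Proof. by rewrite path_rev_zero path_one. Qed.

Lemma rev_one : path_rev p one = x.
Proof. by rewrite path_rev_one path_zero. Qed.

Definition cat_path : {path I from x to z in X} :=
  mk_path (path_cat_continuous cts_fun cts_fun cat_ends) cat_zero cat_one.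

Definition rev_path : {path I from y to x in X} :=
  mk_path (path_rev_continuous cts_fun) rev_zero rev_one.

Lemma cat_pathE (t : I) : cat_path t = path_cat p q t.
Proof. by []. Qed.

Lemma rev_pathE (t : I) : rev_path t = path_rev p t.
Proof. by []. Qed.

End CatRev.

(* Homotopy relative to the endpoints. *)
Definition path_homotopic (x y : X) (p q : {path I from x to y in X}) : Prop :=
  exists H : I * I -> X,
    [/\ continuous H,
        forall t, H (t, zero) = p t,
        forall t, H (t, one) = q t,
        forall s, H (zero, s) = x &
        forall s, H (one, s) = y].

Lemma path_homotopic_refl (x y : X) (p : {path I from x to y in X}) :
  path_homotopic p p.
Proof.
exists (fun z => p z.1); split=> //= [|s|s]; rewrite ?path_zero ?path_one //.
exact: (continuous_compT (@continuous_fstT _ _) cts_fun).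
Qed.

Lemma path_homotopic_sym (x y : X) (p q : {path I from x to y in X}) :
  path_homotopic p q -> path_homotopic q p.
Proof.
move=> [H [cH H0 H1 Hx Hy]]; exists (fun z => path_rev (fun s => H (z.1, s)) z.2).
have c2 : continuous (fun z : I * I => clamp (1 - val z.2)).
  have := @continuous_affine R _ (fun z : I * I => val z.2) (-1) 1
    (continuous_compT (@continuous_sndT _ _) (@continuous_val R)).
  by under eq_fun do rewrite mulN1r addrC.
split=> [|t|t|s|s].
- exact: (continuous_compT (continuous_pairT (@continuous_fstT _ _) c2) cH).
- by rewrite path_rev_zero /= H1.
- by rewrite path_rev_one /= H0.
- exact: Hx.
- exact: Hy.
Qed.

Lemma path_homotopic_trans (x y : X) (q p r : {path I from x to y in X}) :
  path_homotopic p q -> path_homotopic q r -> path_homotopic p r.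
Proof.
move=> [H [cH H0 H1 Hx Hy]] [K [cK K0 K1 Kx Ky]].
exists (fun z => path_cat (fun s => H (z.1, s)) (fun s => K (z.1, s)) z.2).
split=> [|t|t|s|s].
- rewrite /path_cat.
  apply: (@path_cat_continuous_gen R (I * I)%type X (fun z => val z.2)
    (fun z s => H (z.1, s)) (fun z s => K (z.1, s))).
  + exact: (continuous_compT (@continuous_sndT _ _) (@continuous_val R)).
  + apply: continuous_compT cH; apply: continuous_pairT.
      exact: (continuous_compT (@continuous_fstT _ _) (@continuous_fstT _ _)).
    exact: continuous_sndT.
  + apply: continuous_compT cK; apply: continuous_pairT.
      exact: (continuous_compT (@continuous_fstT _ _) (@continuous_fstT _ _)).
    exact: continuous_sndT.
  + by move=> z; rewrite H1 K0.
- by rewrite path_cat_zero.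
- by rewrite path_cat_one.
- by rewrite /path_cat /= Hx Kx; case: ifP.
- by rewrite /path_cat /= Hy Ky; case: ifP.
Qed.

Lemma cat_path_homotopic (x y z : X) (p p' : {path I from x to y in X})
    (q q' : {path I from y to z in X}) :
  path_homotopic p p' -> path_homotopic q q' ->
  path_homotopic (cat_path p q) (cat_path p' q').
Proof.
move=> [H [cH H0 H1 Hx Hy]] [K [cK K0 K1 Kx Ky]].
exists (fun w => path_cat (fun t => H (t, w.2)) (fun t => K (t, w.2)) w.1).
split=> [|t|t|s|s].
- rewrite /path_cat.
  apply: (@path_cat_continuous_gen R (I * I)%type X (fun w => val w.1)
    (fun w t => H (t, w.2)) (fun w t => K (t, w.2))).
  + exact: (continuous_compT (@continuous_fstT _ _) (@continuous_val R)).
  + apply: continuous_compT cH; apply: continuous_pairT.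
      exact: continuous_sndT.
    exact: (continuous_compT (@continuous_fstT _ _) (@continuous_sndT _ _)).
  + apply: continuous_compT cK; apply: continuous_pairT.
      exact: continuous_sndT.
    exact: (continuous_compT (@continuous_fstT _ _) (@continuous_sndT _ _)).
  + by move=> w; rewrite Hy Kx.
- by rewrite /path_cat /= H0 K0 /cat_path /mk_path /path_cat.
- by rewrite /path_cat /= H1 K1 /cat_path /mk_path /path_cat.
- by rewrite path_cat_zero /= Hx.
- by rewrite path_cat_one /= Ky.
Qed.

Lemma rev_path_homotopic (x y : X) (p p' : {path I from x to y in X}) :
  path_homotopic p p' -> path_homotopic (rev_path p) (rev_path p').
Proof.
move=> [H [cH H0 H1 Hx Hy]].
exists (fun w => path_rev (fun t => H (t, w.2)) w.1).
have c1 : continuous (fun z : I * I => clamp (1 - val z.1)).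
  have := @continuous_affine R _ (fun z : I * I => val z.1) (-1) 1
    (continuous_compT (@continuous_fstT _ _) (@continuous_val R)).
  by under eq_fun do rewrite mulN1r addrC.
split=> [|t|t|s|s].
- exact: (continuous_compT (continuous_pairT c1 (@continuous_sndT _ _)) cH).
- by rewrite /path_rev H0.
- by rewrite /path_rev H1.
- by rewrite path_rev_zero /= Hy.
- by rewrite path_rev_one /= Hx.
Qed.

Lemma reparam_homotopic (x y u v : X) (r : {path I from u to v in X})
    (p q : {path I from x to y in X}) (phi psi : I -> R) :
  continuous phi -> continuous psi ->
  phi zero = psi zero -> phi one = psi one ->
  (forall t, p t = r (clamp (phi t))) -> (forall t, q t = r (clamp (psi t))) ->
  path_homotopic p q.
Proof.
move=> cphi cpsi e0 e1 pE qE.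
exists (fun w : I * I =>
  r (clamp (phi w.1 + val w.2 * (psi w.1 - phi w.1)))).
split=> [|t|t|s|s].
- apply: continuous_compT cts_fun; apply: continuous_compT (@continuous_clamp R).
  have c1 := continuous_compT (@continuous_fstT I I) cphi.
  have c2 := continuous_compT (@continuous_fstT I I) cpsi.
  have c3 := continuous_compT (@continuous_sndT I I) (@continuous_val R).
  move=> w; apply: cvgD; first exact: c1.
  by apply: cvgM; [exact: c3|apply: cvgB; [exact: c2|exact: c1]].
- by rewrite val_zero mul0r addr0 pE.
- by rewrite val_one mul1r addrC subrK qE.
- by rewrite e0 subrr mulr0 addr0 -qE path_zero.
- by rewrite e1 subrr mulr0 addr0 -qE path_one.
Qed.

End Homotopy.

Section FundamentalGroup.
Variables (R : realType) (X : topologicalType) (x : X).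
Local Notation I := (unit_interval R).
Local Notation loop := {path I from x to x in X}.

Definition loop_homotopicb (p q : loop) : bool := `[< path_homotopic p q >].

Lemma loop_homotopicb_equiv : equiv_class_of loop_homotopicb.
Proof.
split=> [p|p q|q p r].
- exact/asboolP/path_homotopic_refl.
- by apply/asboolP/asboolP => ?; exact: path_homotopic_sym.
- move=> /asboolP pq /asboolP qr; apply/asboolP.
  exact: path_homotopic_trans pq qr.
Qed.

Canonical loop_homotopic_equiv := EquivRelPack loop_homotopicb_equiv.
Canonical loop_homotopic_encModRel := defaultEncModRel loop_homotopicb.

Definition fundamental_group : Type := {eq_quot loop_homotopicb}.

HB.instance Definition _ := Choice.on fundamental_group.
HB.instance Definition _ : EqQuotient loop loop_homotopicb fundamental_group :=
  EqQuotient.on fundamental_group.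

Definition loop_class (p : loop) : fundamental_group := \pi p.

Lemma loop_classP (p q : loop) :
  loop_class p = loop_class q <-> path_homotopic p q.
Proof. by split=> [/eqmodP/asboolP //|pq]; apply/eqmodP/asboolP. Qed.

Lemma loop_class_ext (p q : loop) : p =1 q -> loop_class p = loop_class q.
Proof. by move=> /path_eqP ->. Qed.

Lemma loop_class_ind (P : fundamental_group -> Prop) :
  (forall p, P (loop_class p)) -> forall g, P g.
Proof. by move=> h g; rewrite -[g]reprK; exact: h. Qed.

Definition pi1_one : fundamental_group :=
  loop_class [the loop of cst x : I -> X].

Definition pi1_mul (g h : fundamental_group) : fundamental_group :=
  loop_class (cat_path (repr g) (repr h)).

Definition pi1_inv (g : fundamental_group) : fundamental_group :=
  loop_class (rev_path (repr g)).

Lemma repr_loop_class (p : loop) : path_homotopic (repr (loop_class p)) p.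
Proof. by apply/loop_classP; rewrite /loop_class reprK. Qed.

Lemma pi1_mulE (p q : loop) :
  pi1_mul (loop_class p) (loop_class q) = loop_class (cat_path p q).
Proof. by apply/loop_classP/cat_path_homotopic; exact: repr_loop_class. Qed.

Lemma pi1_invE (p : loop) : pi1_inv (loop_class p) = loop_class (rev_path p).
Proof. by apply/loop_classP/rev_path_homotopic; exact: repr_loop_class. Qed.

Let cont_lin (a b : R) : continuous ((fun t => a * val t + b) : I -> R).
Proof. exact: (@continuous_lin R I val a b (@continuous_val R)). Qed.

Let cont_if (f g : I -> R) (c : R) : continuous f -> continuous g ->
  (forall t : I, val t = c -> f t = g t) ->
  continuous ((fun t => if val t <= c then f t else g t) : I -> R).
Proof.
move=> cf cg fg; apply: (@continuous_ifle R I R val (fun=> c) f g) => //.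
  exact: (@continuous_val R).
exact: (@cst_continuous _ _ c).
Qed.

Lemma pi1_mul1 : left_id pi1_one pi1_mul.
Proof.
elim/loop_class_ind=> p; rewrite pi1_mulE; apply/loop_classP.
apply: (@reparam_homotopic _ _ _ _ _ _ p _ _ (fun t =>
  if val t <= 2^-1 then 0 * val t + 0 else 2 * val t + -1)
  (fun t => 1 * val t + 0)).
- by apply: cont_if => // t ->; lra.
- exact: cont_lin.
- by rewrite val_zero ifT; lra.
- by rewrite val_one ifF; [lra|apply/negbTE; lra].
- move=> t; rewrite cat_pathE /path_cat; case: ifP => // _.
  by rewrite mul0r addr0 (clamp_le0 (lexx 0)) path_zero.
- by move=> t; rewrite mul1r addr0 clampK.
Qed.

Lemma pi1_mulr1 : right_id pi1_one pi1_mul.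
Proof.
elim/loop_class_ind=> p; rewrite pi1_mulE; apply/loop_classP.
apply: (@reparam_homotopic _ _ _ _ _ _ p _ _ (fun t =>
  if val t <= 2^-1 then 2 * val t + 0 else 0 * val t + 1)
  (fun t => 1 * val t + 0)).
- by apply: cont_if => // t ->; lra.
- exact: cont_lin.
- by rewrite val_zero ifT; lra.
- by rewrite val_one ifF; [lra|apply/negbTE; lra].
- move=> t; rewrite cat_pathE /path_cat; case: ifP => _.
    by rewrite addr0.
  by rewrite mul0r add0r (clamp_ge1 (lexx 1)) path_one.
- by move=> t; rewrite mul1r addr0 clampK.
Qed.

Lemma pi1_mulVg : left_inverse pi1_one pi1_inv pi1_mul.
Proof.
elim/loop_class_ind=> p; rewrite pi1_invE pi1_mulE; apply/loop_classP.
apply: (@reparam_homotopic _ _ _ _ _ _ p _ _ (fun t =>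
  if val t <= 2^-1 then -2 * val t + 1 else 2 * val t + -1)
  (fun t => 0 * val t + 1)).
- by apply: cont_if => // t ->; lra.
- exact: cont_lin.
- by rewrite val_zero ifT; lra.
- by rewrite val_one ifF; [lra|apply/negbTE; lra].
- move=> t; rewrite cat_pathE /path_cat; case: ifP => // t2.
  rewrite rev_pathE /path_rev; congr (p (clamp _)).
  by rewrite clamp_id; [lra|have /andP[] := unit_intervalP t; lra].
- by move=> t; rewrite mul0r add0r (clamp_ge1 (lexx 1)) path_one.
Qed.

Lemma pi1_mulgV : right_inverse pi1_one pi1_inv pi1_mul.
Proof.
elim/loop_class_ind=> p; rewrite pi1_invE pi1_mulE; apply/loop_classP.
apply: (@reparam_homotopic _ _ _ _ _ _ p _ _ (fun t =>
  if val t <= 2^-1 then 2 * val t + 0 else -2 * val t + 2)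
  (fun t => 0 * val t + 0)).
- by apply: cont_if => // t ->; lra.
- exact: cont_lin.
- by rewrite val_zero ifT; lra.
- by rewrite val_one ifF; [lra|apply/negbTE; lra].
- move=> t; rewrite cat_pathE /path_cat; case: ifPn => t2.
    by rewrite addr0.
  rewrite rev_pathE /path_rev; congr (p (clamp _)).
  rewrite clamp_id; first lra.
  by move: t2; rewrite -ltNge => t2; have /andP[] := unit_intervalP t; lra.
- by move=> t; rewrite mul0r addr0 (clamp_le0 (lexx 0)) path_zero.
Qed.

Lemma pi1_mulA : associative pi1_mul.
Proof.
elim/loop_class_ind=> p; elim/loop_class_ind=> q; elim/loop_class_ind=> r.
rewrite !pi1_mulE; apply/loop_classP.
apply: (@reparam_homotopic _ _ _ _ _ _ (cat_path (cat_path p q) r) _ _ (fun t =>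
  if val t <= 2^-1 then 2^-1 * val t + 0 else
  if val t <= 3 / 4 then 1 * val t + - 4^-1 else 2 * val t + -1)
  (fun t => 1 * val t + 0)).
- apply: cont_if => // [|t ->]; first by apply: cont_if => // t ->; lra.
  by rewrite ifT; lra.
- exact: cont_lin.
- by rewrite val_zero ifT; lra.
- by rewrite val_one ifF; [rewrite ifF; [lra|apply/negbTE; lra]|apply/negbTE; lra].
- move=> t; have /andP[t0 t1] := unit_intervalP t.
  rewrite !cat_pathE /path_cat; case: ifPn => t2.
    rewrite clamp_id; last lra.
    rewrite ifT; last lra.
    rewrite cat_pathE /path_cat clamp_id; last lra.
    by rewrite ifT; [congr (p (clamp _))|]; lra.
  move: t2; rewrite -ltNge => t2.
  rewrite cat_pathE /path_cat clamp_id; last lra.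
  case: (leP (val t) (3 / 4)) => t3.
    rewrite clamp_id; last lra.
    rewrite !ifT; [|lra..].
    rewrite cat_pathE /path_cat clamp_id; last lra.
    by rewrite ifF; [congr (q (clamp _)); lra|apply/negbTE; lra].
  rewrite clamp_id; last lra.
  rewrite ifF; last by apply/negbTE; lra.
  rewrite ifF; last by apply/negbTE; lra.
  by congr (r (clamp _)); lra.
- by move=> t; rewrite mul1r addr0 clampK.
Qed.

HB.instance Definition _ := isGroup.Build fundamental_group
  pi1_mulA pi1_mul1 pi1_mulr1 pi1_mulVg pi1_mulgV.

End FundamentalGroup.

Section InducedMap.
Variables (R : realType) (X Y : topologicalType).
Variables (f : continuousType X Y) (x : X) (y : Y) (fx : f x = y).
Local Notation I := (unit_interval R).

Section Push.
Variable p : {path I from x to x in X}.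

Lemma push_zero : (f \o p) zero = y.
Proof. by rewrite /= path_zero fx. Qed.

Lemma push_one : (f \o p) one = y.
Proof. by rewrite /= path_one fx. Qed.

Lemma push_continuous : continuous (f \o p).
Proof. exact: (continuous_compT cts_fun cts_fun). Qed.

Definition push_loop : {path I from y to y in Y} :=
  mk_path push_continuous push_zero push_one.

End Push.

Lemma push_loop_homotopic (p q : {path I from x to x in X}) :
  path_homotopic p q -> path_homotopic (push_loop p) (push_loop q).
Proof.
move=> [H [cH H0 H1 Hx Hy]]; exists (fun z => f (H z)).
by split=> [|t|t|s|s]; rewrite ?(H0, H1, Hx, Hy) //;
  exact: (continuous_compT cH cts_fun).
Qed.

Definition pi1_map (g : fundamental_group R x) : fundamental_group R y :=
  loop_class (push_loop (repr g)).

Lemma pi1_mapE (p : {path I from x to x in X}) :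
  pi1_map (loop_class p) = loop_class (push_loop p).
Proof. by apply/loop_classP/push_loop_homotopic; exact: repr_loop_class. Qed.

Lemma pi1_map1 : pi1_map 1%g = 1%g.
Proof. by rewrite [LHS]pi1_mapE; exact: loop_class_ext. Qed.

Lemma pi1_mapM : {morph pi1_map : g h / (g * h)%g}.
Proof.
elim/loop_class_ind=> p; elim/loop_class_ind=> q.
rewrite [X in pi1_map X]pi1_mulE !pi1_mapE [RHS]pi1_mulE.
apply: loop_class_ext => t.
by rewrite cat_pathE -[LHS]/((f \o path_cat p q) t) path_cat_comp.
Qed.

HB.instance Definition _ := isMultiplicative.Build
  (fundamental_group R x) (fundamental_group R y) pi1_map pi1_mapM.
HB.instance Definition _ := Multiplicative_isUMagmaMorphism.Build
  (fundamental_group R x) (fundamental_group R y) pi1_map pi1_map1.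

End InducedMap.

(* [(i, false)] is the generator x_i and [(i, true)] its inverse. *)
Definition letter (n : nat) : Type := ('I_n * bool)%type.

Definition letter_inv n (a : letter n) : letter n := (a.1, ~~ a.2).

Definition word (n : nat) : Type := seq (letter n).

(* Relators are words, not necessarily reduced: the presentation complex
   depends on the word chosen to represent an element of the free group. *)
Definition presentation (n m : nat) : Type := 'I_m -> word n.

Definition exponent_sum n (i : 'I_n) (w : word n) : int :=
  \sum_(a <- w | a.1 == i) (-1) ^+ a.2.

Definition exponent_matrix n m (P : presentation n m) : 'M[int]_(m, n) :=
  \matrix_(k, i) exponent_sum i (P k).

(* The index of the first nonzero entry of row [k], or [n] if that row is 0. *)
Definition leading_column n m (A : 'M[int]_(m, n)) (k : 'I_m) : nat :=
  find (fun i => A k i != 0) (enum 'I_n).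

(* Since a zero row has leading column [n], this also forces the zero rows to
   be at the bottom. *)
Definition row_echelon n m (A : 'M[int]_(m, n)) : Prop :=
  forall k l : 'I_m, (k < l)%N ->
    row l A = 0 \/ (leading_column A k < leading_column A l)%N.

Definition echelon_presentation n m (P : presentation n m) : Prop :=
  row_echelon (exponent_matrix P).

Section PresentedGroup.
Variables (n m : nat) (P : presentation n m).

(* Two words are equivalent when they represent the same element of the
   quotient of the free group by the normal closure of the relators. *)
Inductive word_equiv : word n -> word n -> Prop :=
| word_equiv_refl u : word_equiv u u
| word_equiv_sym u v : word_equiv u v -> word_equiv v u
| word_equiv_trans u v w : word_equiv u v -> word_equiv v w -> word_equiv u w
| word_equiv_cancel u a v : word_equiv (u ++ a :: letter_inv a :: v) (u ++ v)
| word_equiv_relator u k v : word_equiv (u ++ P k ++ v) (u ++ v).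

Definition word_equivb (u v : word n) : bool := `[< word_equiv u v >].

Lemma word_equivb_equiv : equiv_class_of word_equivb.
Proof.
split=> [u|u v|v u w].
- exact/asboolP/word_equiv_refl.
- by apply/asboolP/asboolP => ?; exact: word_equiv_sym.
- move=> /asboolP uv /asboolP vw; apply/asboolP.
  exact: word_equiv_trans uv vw.
Qed.

Canonical word_equiv_equiv := EquivRelPack word_equivb_equiv.
Canonical word_equiv_encModRel := defaultEncModRel word_equivb.

Definition presented_group : Type := {eq_quot word_equivb}.

HB.instance Definition _ := Choice.on presented_group.
HB.instance Definition _ : EqQuotient (word n) word_equivb presented_group :=
  EqQuotient.on presented_group.

Definition word_class (w : word n) : presented_group := \pi w.

Lemma word_classP (u v : word n) : word_class u = word_class v <-> word_equiv u v.
Proof. by split=> [/eqmodP/asboolP //|uv]; apply/eqmodP/asboolP. Qed.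

Lemma word_class_ind (Q : presented_group -> Prop) :
  (forall w, Q (word_class w)) -> forall g, Q g.
Proof. by move=> h g; rewrite -[g]reprK; exact: h. Qed.

Lemma repr_word_class (w : word n) : word_equiv (repr (word_class w)) w.
Proof. by apply/word_classP; rewrite /word_class reprK. Qed.

Definition word_inv (w : word n) : word n := rev (map (@letter_inv n) w).

Lemma word_equiv_ctx (a b u v : word n) :
  word_equiv u v -> word_equiv (a ++ u ++ b) (a ++ v ++ b).
Proof.
elim=> {u v} [u|u v _|u v w _ uv _|u c v|u k v].
- exact: word_equiv_refl.
- exact: word_equiv_sym.
- exact: word_equiv_trans uv.
- by rewrite -!catA !(catA a) /=; exact: word_equiv_cancel.
- by rewrite -!catA !(catA a); exact: word_equiv_relator.
Qed.

Lemma word_equiv_cat (u u' v v' : word n) :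
  word_equiv u u' -> word_equiv v v' -> word_equiv (u ++ v) (u' ++ v').
Proof.
move=> uu' vv'; apply: (@word_equiv_trans _ (u' ++ v)).
  exact: (@word_equiv_ctx [::] v).
by have := @word_equiv_ctx u' [::] _ _ vv'; rewrite !cats0.
Qed.

Lemma letter_invK : involutive (@letter_inv n).
Proof. by case=> i b; rewrite /letter_inv /= negbK. Qed.

Lemma word_invK : involutive word_inv.
Proof.
move=> w; rewrite /word_inv map_rev revK -map_comp.
by rewrite -[RHS]map_id; apply: eq_map => a /=; rewrite letter_invK.
Qed.

Lemma word_equiv_mulVw (w : word n) : word_equiv (word_inv w ++ w) [::].
Proof.
elim: w => [|a w IH]; first exact: word_equiv_refl.
apply: word_equiv_trans IH; rewrite /word_inv /= rev_cons cat_rcons.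
by rewrite -{2}[a]letter_invK; exact: word_equiv_cancel.
Qed.

Lemma word_equiv_mulwV (w : word n) : word_equiv (w ++ word_inv w) [::].
Proof. by rewrite -{1}[w]word_invK; exact: word_equiv_mulVw. Qed.

Lemma word_equiv_inv (u v : word n) :
  word_equiv u v -> word_equiv (word_inv u) (word_inv v).
Proof.
move=> uv; apply: (@word_equiv_trans _ (word_inv u ++ v ++ word_inv v)).
  apply: word_equiv_sym; rewrite -[X in word_equiv _ X]cats0.
  apply: word_equiv_cat; first exact: word_equiv_refl.
  exact: word_equiv_mulwV.
rewrite catA -[X in word_equiv _ X]cat0s.
apply: word_equiv_cat; last exact: word_equiv_refl.
apply: word_equiv_trans (word_equiv_mulVw u).
apply: word_equiv_cat; first exact: word_equiv_refl.
exact: word_equiv_sym.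
Qed.

Definition pres_one : presented_group := word_class [::].

Definition pres_mul (g h : presented_group) : presented_group :=
  word_class (repr g ++ repr h).

Definition pres_inv (g : presented_group) : presented_group :=
  word_class (word_inv (repr g)).

Lemma pres_mulE (u v : word n) :
  pres_mul (word_class u) (word_class v) = word_class (u ++ v).
Proof. by apply/word_classP/word_equiv_cat; exact: repr_word_class. Qed.

Lemma pres_invE (w : word n) : pres_inv (word_class w) = word_class (word_inv w).
Proof. by apply/word_classP/word_equiv_inv; exact: repr_word_class. Qed.

Lemma pres_mulA : associative pres_mul.
Proof.
elim/word_class_ind=> u; elim/word_class_ind=> v; elim/word_class_ind=> w.
by rewrite !pres_mulE catA.
Qed.

Lemma pres_mul1 : left_id pres_one pres_mul.
Proof. by elim/word_class_ind=> w; rewrite pres_mulE. Qed.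

Lemma pres_mulr1 : right_id pres_one pres_mul.
Proof. by elim/word_class_ind=> w; rewrite pres_mulE cats0. Qed.

Lemma pres_mulVg : left_inverse pres_one pres_inv pres_mul.
Proof.
elim/word_class_ind=> w; rewrite pres_invE pres_mulE.
exact/word_classP/word_equiv_mulVw.
Qed.

Lemma pres_mulgV : right_inverse pres_one pres_inv pres_mul.
Proof.
elim/word_class_ind=> w; rewrite pres_invE pres_mulE.
exact/word_classP/word_equiv_mulwV.
Qed.

HB.instance Definition _ := isGroup.Build presented_group
  pres_mulA pres_mul1 pres_mulr1 pres_mulVg pres_mulgV.

End PresentedGroup.

Definition open_interval (R : realType) : Type := set_type (`]0, 1[%classic : set R).

HB.instance Definition _ (R : realType) := SubType.on (open_interval R).

(* A CW complex is, as a set, the disjoint union of its open cells. The closed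
   1-cells are modelled by [0, 1], the closed 2-cells by [0, 1] x [0, 1]. *)
Inductive pres_complex (R : realType) n m (P : presentation n m) : Type :=
| Cell0
| Cell1 of 'I_n & open_interval R
| Cell2 of 'I_m & open_interval R & open_interval R.

Arguments Cell0 {R n m P}.
Arguments Cell1 {R n m P}.
Arguments Cell2 {R n m P}.

HB.instance Definition _ R n m (P : presentation n m) :=
  gen_eqMixin (pres_complex R P).
HB.instance Definition _ R n m (P : presentation n m) :=
  gen_choiceMixin (pres_complex R P).

Section PresentationComplex.
Variables (R : realType) (n m : nat) (P : presentation n m).
Local Notation I := (unit_interval R).
Local Notation K := (pres_complex R P).

(* The characteristic maps of the closed cells. On the boundary of the k-th
   square, [char_map2 k] follows the loop of the k-th relator along the side
   [0, 1] x {0} and is constant, equal to the 0-cell, on the other three sides: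
   this is the attaching map of the 2-cell. *)
Definition char_map1 (i : 'I_n) (t : I) : K :=
  if insub (val t) is Some u then Cell1 i u else Cell0.

Definition letter_map (a : letter n) : I -> K :=
  if a.2 then path_rev (char_map1 a.1) else char_map1 a.1.

Definition word_map (w : word n) : I -> K :=
  foldr (fun a => path_cat (letter_map a)) (cst Cell0) w.

Definition char_map2 (k : 'I_m) (z : I * I) : K :=
  match insub (val z.1), insub (val z.2) with
  | Some u, Some v => Cell2 k u v
  | _, _ => if val z.2 == 0 then word_map (P k) z.1 else Cell0
  end.

(* The weak topology: a set is open when its preimages under all the
   characteristic maps are open. *)
Definition pres_open : set (set K) := [set U |
  (forall i, open (char_map1 i @^-1` U)) /\
  (forall k, open (char_map2 k @^-1` U))].

Lemma pres_openT : pres_open setT.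
Proof. by split=> *; rewrite preimage_setT; exact: openT. Qed.

Lemma pres_openI : setI_closed pres_open.
Proof.
by move=> U V [U1 U2] [V1 V2]; split=> j; rewrite preimage_setI;
  apply: openI.
Qed.

Lemma pres_open_bigcup (J : Type) (F : J -> set K) :
  (forall j, pres_open (F j)) -> pres_open (\bigcup_j F j).
Proof.
by move=> oF; split=> i; rewrite preimage_bigcup; apply: bigcup_open => j _;
  have [] := oF j.
Qed.

HB.instance Definition _ :=
  isOpenTopological.Build K pres_openT pres_openI pres_open_bigcup.

Lemma char_map1_continuous i : continuous (char_map1 i).
Proof. by apply/continuousP => U [+ _]; apply. Qed.

Lemma char_map2_continuous k : continuous (char_map2 k).
Proof. by apply/continuousP => U [_]; apply. Qed.

Lemma insub_interval_zero : insub (val (zero : I)) = None :> option (open_interval R).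
Proof.
by apply: insubF; apply/negbTE; rewrite val_zero notin_setE /= in_itv /= ltxx.
Qed.

Lemma insub_interval_one : insub (val (one : I)) = None :> option (open_interval R).
Proof.
by apply: insubF; apply/negbTE; rewrite val_one notin_setE /= in_itv /= ltxx andbF.
Qed.

Lemma char_map1_zero i : char_map1 i zero = Cell0.
Proof. by rewrite /char_map1 insub_interval_zero. Qed.

Lemma char_map1_one i : char_map1 i one = Cell0.
Proof. by rewrite /char_map1 insub_interval_one. Qed.

Lemma letter_map_zero a : letter_map a zero = Cell0.
Proof.
rewrite /letter_map; case: a.2; last exact: char_map1_zero.
by rewrite path_rev_zero char_map1_one.
Qed.

Lemma letter_map_one a : letter_map a one = Cell0.
Proof.
rewrite /letter_map; case: a.2; last exact: char_map1_one.
by rewrite path_rev_one char_map1_zero.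
Qed.

Lemma letter_map_continuous a : continuous (letter_map a).
Proof.
rewrite /letter_map; case: a.2; last exact: char_map1_continuous.
exact/path_rev_continuous/char_map1_continuous.
Qed.

Lemma word_map_zero w : word_map w zero = Cell0.
Proof. by case: w => //= a w; rewrite path_cat_zero letter_map_zero. Qed.

Lemma word_map_one w : word_map w one = Cell0.
Proof. by elim: w => //= a w IH; rewrite path_cat_one. Qed.

Lemma word_map_continuous w : continuous (word_map w).
Proof.
elim: w => [|a w IH]; first exact: (@cst_continuous _ _ Cell0).
apply: path_cat_continuous => //; first exact: letter_map_continuous.
by rewrite letter_map_one; exact/esym/word_map_zero.
Qed.

Local Notation loop := {path I from Cell0 to Cell0 in K}.

Definition letter_loop (a : letter n) : loop :=
  mk_path (@letter_map_continuous a) (letter_map_zero a) (letter_map_one a).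

Definition word_loop (w : word n) : loop :=
  mk_path (@word_map_continuous w) (word_map_zero w) (word_map_one w).

Local Open Scope group_scope.

Lemma word_loop_nil : loop_class (word_loop [::]) = 1.
Proof. exact: loop_class_ext. Qed.

Lemma word_loop_cons a w :
  loop_class (word_loop (a :: w)) =
  loop_class (letter_loop a) * loop_class (word_loop w).
Proof. by rewrite [RHS]pi1_mulE; exact: loop_class_ext. Qed.

Lemma word_loop_cat u v :
  loop_class (word_loop (u ++ v)) =
  loop_class (word_loop u) * loop_class (word_loop v).
Proof.
elim: u => [|a u IH]; first by rewrite word_loop_nil mul1g.
by rewrite cat_cons !word_loop_cons IH mulgA.
Qed.

Lemma letter_loop_inv a :
  loop_class (letter_loop (letter_inv a)) = (loop_class (letter_loop a))^-1.
Proof.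
have E i : loop_class (letter_loop (i, true)) =
    (loop_class (letter_loop (i, false)))^-1.
  by rewrite [RHS]pi1_invE; exact: loop_class_ext.
by case: a => i []; rewrite /letter_inv /= E ?invgK.
Qed.

Lemma relator_loop k : loop_class (word_loop (P k)) = 1.
Proof.
apply/loop_classP; exists (char_map2 k); split=> [|t|t|s|s].
- exact: char_map2_continuous.
- by rewrite /char_map2 insub_interval_zero val_zero eqxx; case: insub.
- by rewrite /char_map2 insub_interval_one val_one oner_eq0; case: insub.
- by rewrite /char_map2 insub_interval_zero; case: ifP => // _; exact: word_map_zero.
- by rewrite /char_map2 insub_interval_one; case: ifP => // _; exact: word_map_one.
Qed.

Lemma word_loop_equiv u v :
  word_equiv P u v -> loop_class (word_loop u) = loop_class (word_loop v).
Proof.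
elim=> {u v} // [u v w _ -> _ -> //|u a v|u k v].
  by rewrite !word_loop_cat !word_loop_cons letter_loop_inv mulVKg.
by rewrite !word_loop_cat relator_loop mul1g.
Qed.

(* The canonical homomorphism from the presented group to the fundamental group
   of its presentation complex, x_i being sent to the class of the i-th 1-cell;
   by van Kampen's theorem it is an isomorphism, along which the two groups are
   identified. *)
Definition group_to_pi1 (g : presented_group P) : fundamental_group R (Cell0 : K) :=
  loop_class (word_loop (repr g)).

Lemma group_to_pi1E w : group_to_pi1 (word_class P w) = loop_class (word_loop w).
Proof. exact/word_loop_equiv/repr_word_class. Qed.

Lemma group_to_pi1_1 : group_to_pi1 1 = 1.
Proof. by rewrite [LHS]group_to_pi1E word_loop_nil. Qed.

Lemma group_to_pi1M : {morph group_to_pi1 : g h / g * h}.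
Proof.
elim/word_class_ind=> u; elim/word_class_ind=> v.
by rewrite [X in group_to_pi1 X]pres_mulE !group_to_pi1E word_loop_cat.
Qed.

HB.instance Definition _ := isMultiplicative.Build (presented_group P)
  (fundamental_group R (Cell0 : K)) group_to_pi1 group_to_pi1M.
HB.instance Definition _ := Multiplicative_isUMagmaMorphism.Build
  (presented_group P) (fundamental_group R (Cell0 : K)) group_to_pi1
  group_to_pi1_1.

End PresentationComplex.

Definition std_simplex (R : realType) (q : nat) : set 'rV[R]_q.+1 :=
  [set v | (forall i, 0 <= v ord0 i) /\ \sum_i v ord0 i = 1].

Definition simplex (R : realType) (q : nat) : Type := set_type (@std_simplex R q).

HB.instance Definition _ (R : realType) (q : nat) := SubType.on (simplex R q).
HB.instance Definition _ (R : realType) (q : nat) := Topological.on (simplex R q).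

Section Faces.
Variables (R : realType) (q : nat).

(* The [i]-th coface inserts a zero at the [i]-th barycentric coordinate. *)
Definition face_row (i : 'I_q.+2) (v : 'rV[R]_q.+1) : 'rV[R]_q.+2 :=
  \row_j (if unlift i j is Some k then v ord0 k else 0).

Lemma face_subproof (i : 'I_q.+2) (v : simplex R q) :
  face_row i (val v) \in @std_simplex R q.+1.
Proof.
case: v => v /= /set_mem [v0 v1]; apply/mem_set; split=> [j|].
  by rewrite mxE; case: unliftP => [k _|_] //; exact: v0.
rewrite (bigD1_ord i) //= mxE unlift_none add0r -v1.
by apply: eq_bigr => k _; rewrite mxE liftK.
Qed.

Definition face (i : 'I_q.+2) (v : simplex R q) : simplex R q.+1 :=
  exist (fun y => is_true (y \in @std_simplex R q.+1)) _ (face_subproof i v).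

Lemma face_row_continuous (i : 'I_q.+2) : continuous (face_row i).
Proof.
move=> v A [P Pv PA]; rewrite nbhs_simpl /=.
exists (fun i0 k => P i0 (lift i k)).
  by move=> i0 k; have := Pv i0 (lift i k); rewrite ord1 mxE liftK.
move=> w Pw; apply: PA => i0 j; rewrite mxE.
case: unliftP => [k ->|ji]; first by rewrite [i0]ord1; exact: Pw.
by have := Pv i0 j; rewrite mxE ji unlift_none => /nbhs_singleton.
Qed.

Lemma face_continuous (i : 'I_q.+2) : continuous (face i).
Proof.
apply: continuous_comp_initial.
change (continuous (face_row i \o (set_val : simplex R q -> 'rV[R]_q.+1))).
move=> v; apply: continuous_comp; last exact: face_row_continuous.
exact: initial_continuous.
Qed.

HB.instance Definition _ (i : 'I_q.+2) :=
  isContinuous.Build (simplex R q) (simplex R q.+1) (face i) (@face_continuous i).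

End Faces.

Section SingularCohomology.
Variables (R : realType) (X : topologicalType).

Definition singular_simplex (q : nat) : Type := continuousType (simplex R q) X.

Definition cochain (q : nat) : Type := singular_simplex q -> int.

HB.instance Definition _ q := GRing.Zmodule.on (cochain q).

Definition singular_face q (i : 'I_q.+2) (s : singular_simplex q.+1) :
  singular_simplex q := [the continuousType _ _ of s \o face i].

Definition coboundary q (c : cochain q) : cochain q.+1 :=
  fun s => \sum_(i < q.+2) (-1) ^+ i * c (singular_face i s).

Lemma coboundary_is_zmod_morphism q : zmod_morphism (@coboundary q).
Proof.
move=> c d; apply/funext => s.
rewrite /coboundary [RHS](_ : _ =
  \sum_(i < q.+2) (-1) ^+ i * c (singular_face i s) -
  \sum_(i < q.+2) (-1) ^+ i * d (singular_face i s)) //.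
by rewrite -sumrB; apply: eq_bigr => i _; rewrite -mulrBr.
Qed.

HB.instance Definition _ q := GRing.isZmodMorphism.Build
  (cochain q) (cochain q.+1) (@coboundary q) (@coboundary_is_zmod_morphism q).

Definition is_cocycle q : {pred cochain q} := fun c => `[< coboundary c = 0 >].

Lemma is_cocycle_zmod_closed q : zmod_closed (@is_cocycle q).
Proof.
split=> [|c d /asboolP c0 /asboolP d0]; apply/asboolP; first exact: raddf0.
by rewrite coboundary_is_zmod_morphism c0 d0 subr0.
Qed.

HB.instance Definition _ q :=
  GRing.isZmodClosed.Build (cochain q) (@is_cocycle q) (@is_cocycle_zmod_closed q).

Record cocycle (q : nat) : Type :=
  Cocycle { cocycle_val : cochain q; cocycleP : cocycle_val \in @is_cocycle q }.

HB.instance Definition _ q := [isSub for @cocycle_val q].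
HB.instance Definition _ q := [Choice of cocycle q by <:].
HB.instance Definition _ q := [SubChoice_isSubZmodule of cocycle q by <:].

Definition coboundaries (q : nat) : set (cochain q) :=
  match q with 0 => [set 0] | q'.+1 => range (@coboundary q') end.

Definition is_coboundary q : {pred cocycle q} :=
  fun z => `[< coboundaries (val z) >].

Lemma is_coboundary_zmod_closed q : zmod_closed (@is_coboundary q).
Proof.
split=> [|y z].
  apply/asboolP; rewrite raddf0; case: q => [|q] //=.
  by exists 0 => //; rewrite raddf0.
move=> /asboolP yB /asboolP zB; apply/asboolP; rewrite raddfB.
case: q y z yB zB => [|q] y z /=; first by move=> -> ->; rewrite subr0.
by move=> [b _ <-] [c _ <-]; exists (b - c) => //; rewrite raddfB.
Qed.

HB.instance Definition _ q := GRing.isZmodClosed.Build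
  (cocycle q) (@is_coboundary q) (@is_coboundary_zmod_closed q).

Definition cohomology (q : nat) : Type := {ideal_quot (@is_coboundary q)}.

HB.instance Definition _ q := GRing.Zmodule.on (cohomology q).

Definition cohomology_class q (z : cocycle q) : cohomology q :=
  \pi_({ideal_quot (@is_coboundary q)}) z.

Lemma cohomology_classP q (y z : cocycle q) :
  cohomology_class y = cohomology_class z <-> coboundaries (val (y - z)).
Proof.
rewrite /cohomology_class; split.
  by move/eqP; rewrite -Quotient.idealrBE => /asboolP.
by move=> yz; apply/eqP; rewrite -Quotient.idealrBE; exact/asboolP.
Qed.

End SingularCohomology.

Section CohomologyMap.
Variables (R : realType) (X Y : topologicalType) (f : continuousType X Y).

Definition cochain_map q (c : cochain R Y q) : cochain R X q :=
  fun s => c [the continuousType _ _ of f \o s].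

Lemma cochain_map_is_zmod_morphism q : zmod_morphism (@cochain_map q).
Proof. by move=> c d; apply/funext. Qed.

HB.instance Definition _ q := GRing.isZmodMorphism.Build
  (cochain R Y q) (cochain R X q) (@cochain_map q)
  (@cochain_map_is_zmod_morphism q).

Lemma coboundary_cochain_map q (c : cochain R Y q) :
  coboundary (cochain_map c) = cochain_map (coboundary c).
Proof.
apply/funext => s; apply: eq_bigr => i _; congr (_ * c _).
exact/continuousEP.
Qed.

Lemma cocycle_map_subproof q (z : cocycle R Y q) :
  cochain_map (val z) \in @is_cocycle R X q.
Proof.
apply/asboolP; rewrite coboundary_cochain_map.
by have /asboolP -> := cocycleP z; rewrite raddf0.
Qed.

Definition cocycle_map q (z : cocycle R Y q) : cocycle R X q :=
  Cocycle (cocycle_map_subproof z).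

Lemma cocycle_map_is_zmod_morphism q : zmod_morphism (@cocycle_map q).
Proof. by move=> y z; apply: val_inj; rewrite /= !raddfB. Qed.

HB.instance Definition _ q := GRing.isZmodMorphism.Build
  (cocycle R Y q) (cocycle R X q) (@cocycle_map q)
  (@cocycle_map_is_zmod_morphism q).

Lemma cocycle_map_coboundary q (z : cocycle R Y q) :
  coboundaries (val z) -> coboundaries (val (cocycle_map z)).
Proof.
case: q z => [|q] z /=; first by move=> ->; rewrite raddf0.
by move=> [c _ <-]; exists (cochain_map c) => //; exact: coboundary_cochain_map.
Qed.

Definition cohomology_map q (h : cohomology R Y q) : cohomology R X q :=
  cohomology_class (cocycle_map (repr h)).

Lemma cohomology_mapE q (z : cocycle R Y q) :
  cohomology_map (cohomology_class z) = cohomology_class (cocycle_map z).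
Proof.
apply/cohomology_classP; rewrite -raddfB; apply: cocycle_map_coboundary.
by apply/cohomology_classP; rewrite /cohomology_class reprK.
Qed.

Lemma cohomology_map_is_zmod_morphism q : zmod_morphism (@cohomology_map q).
Proof.
move=> g h; rewrite -[g]reprK -[h]reprK -!/(cohomology_class _).
have classB (Z : topologicalType) (y z : cocycle R Z q) :
  cohomology_class y - cohomology_class z = cohomology_class (y - z).
  by rewrite /cohomology_class -raddfB.
by rewrite classB !cohomology_mapE raddfB classB.
Qed.

HB.instance Definition _ q := GRing.isZmodMorphism.Build
  (cohomology R Y q) (cohomology R X q) (@cohomology_map q)
  (@cohomology_map_is_zmod_morphism q).

End CohomologyMap.

Arguments group_to_pi1 R {n m P} g.
Arguments cohomology_map R {X Y} f q h.

(* Main.v *)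
(** Integer row operations on the exponent matrix lift to the relators: adding
    plus or minus the l-th row to the k-th one amounts to replacing the relator
    P_k by P_k P_l or P_k P_l^-1.  This changes neither the presented group nor
    the homotopy type of the presentation complex, because the attaching loop of
    the k-th 2-cell moves by a homotopy in the complement of that cell.  Euclid's
    algorithm uses only such operations, so an echelon presentation of G itself
    is reached, with f a based homotopy equivalence. *)

From HB Require Import structures.
Require Import Defs.
From mathcomp Require Import all_boot all_order all_algebra.
From mathcomp Require Import all_classical all_reals topology normedtype.
From mathcomp Require Import continuous_path.
From mathcomp Require Import zify lra.

Set Implicit Arguments.
Unset Strict Implicit.
Unset Printing Implicit Defensive.

Import Order.TTheory GRing.Theory Num.Theory.
Import numFieldNormedType.Exports.

Local Open Scope classical_set_scope.
Local Open Scope ring_scope.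

(** * Homotopy invariance of singular cohomology *)

(** Cohomology here is singular, so bijectivity of [f^*] is not read off cellular cochains: it comes
    from homotopy invariance, proved with the prism operator and applied to two mutually inverse
    slides. The delicate point is the continuity of a homotopy on a complex times the time axis,
    because a product need not carry the weak topology; local compactness of the time factor settles
    it. Time therefore runs over all of [R], with the two maps sitting at times 0 and 1. A slide is
    governed by how the height in a single cell is reparametrised along a collar, so homotopies of
    maps reduce to homotopies of real functions fixing 0 and 1. On the matrix side additions of rows
    suffice because pivots may have either sign, and a pivot is moved up by two additions instead of
    an interchange. *)

Lemma continuous_bigsum (R : realType) (T : topologicalType) (I : Type)
    (r : seq I) (Q : pred I) (F : I -> T -> R) :
  (forall i, continuous (F i)) -> continuous (fun t => \sum_(i <- r | Q i) F i t).
Proof.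
move=> cF t; elim: r => [|i r IH].
  by under eq_fun do rewrite big_nil; exact: cvg_cst.
under eq_fun do rewrite big_cons.
by case: (Q i) => //; apply: cvgD => //; exact: cF.
Qed.

Lemma continuous_row (R : realType) (T : topologicalType) q (F : T -> 'rV[R]_q) :
  (forall k, continuous (fun t => F t ord0 k)) -> continuous F.
Proof.
move=> cF t A [Q Qt QA]; rewrite nbhs_simpl /=.
have : \forall s \near t, forall k, Q ord0 k (F s ord0 k).
  by apply: filter_forall => k; exact: (cF k t _ (Qt ord0 k)).
by apply: filterS => s Qs; apply: QA => i k; rewrite ord1.
Qed.

(** * Affine maps between standard simplices *)

Section VertexMap.
Variables (R : realType) (p q : nat).
Implicit Types (th : 'I_p.+1 -> 'I_q.+1) (chi : pred 'I_p.+1).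

(** This is the affine map sending the [j]-th vertex to the vertex [th j], in barycentric
    coordinates. *)
Definition vertex_row th (v : 'rV[R]_p.+1) : 'rV[R]_q.+1 :=
  \row_k \sum_(j | th j == k) v ord0 j.

Lemma vertex_subproof th (v : simplex R p) :
  vertex_row th (val v) \in @std_simplex R q.
Proof.
case: v => v /= /set_mem [v0 v1]; apply/mem_set; split=> [j|].
  by rewrite mxE; apply: sumr_ge0 => i _; exact: v0.
under eq_bigr do rewrite mxE.
by rewrite -v1 (partition_big th xpredT).
Qed.

Definition vertex_map th (v : simplex R p) : simplex R q :=
  exist (fun y => is_true (y \in @std_simplex R q)) _ (vertex_subproof th v).

Lemma continuous_coord (j : 'I_p.+1) :
  continuous (fun v : simplex R p => val v ord0 j : R).
Proof.
move=> v; apply: (@continuous_comp _ _ _ (set_val : simplex R p -> 'rV[R]_p.+1)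
  (fun M : 'rV[R]_p.+1 => M ord0 j)); last exact: coord_continuous.
exact: initial_continuous.
Qed.

Lemma vertex_map_continuous th : continuous (vertex_map th).
Proof.
apply: continuous_comp_initial; apply: continuous_row => k /=.
under eq_fun do rewrite mxE.
apply: continuous_bigsum => j; exact: continuous_coord.
Qed.

(** This affine function is 1 on the vertices in [chi] and 0 on the others; it serves as the height
    in a prism. *)
Definition weight chi (v : simplex R p) : R := \sum_(j | chi j) val v ord0 j.

Lemma weight_continuous chi : continuous (weight chi).
Proof. by apply: continuous_bigsum => j; exact: continuous_coord. Qed.

End VertexMap.

Lemma vertex_map_id (R : realType) p (v : simplex R p) : vertex_map id v = v.
Proof.
apply: val_inj; apply/rowP => k /=; rewrite mxE.
by rewrite (big_pred1 k).
Qed.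

Lemma weight_predT (R : realType) p (v : simplex R p) : weight xpredT v = 1.
Proof. by have /set_mem[] := valP v. Qed.

Lemma weight_pred0 (R : realType) p (v : simplex R p) : weight xpred0 v = 0.
Proof. exact: big_pred0. Qed.

Lemma sum_face_row (R : realType) p (Q : pred 'I_p.+2) (i : 'I_p.+2)
    (v : 'rV[R]_p.+1) :
  \sum_(j | Q j) face_row i v ord0 j = \sum_(j | Q (lift i j)) v ord0 j.
Proof.
rewrite big_mkcond (bigD1_ord i) //= mxE unlift_none if_same add0r [RHS]big_mkcond.
by apply: eq_bigr => j _; rewrite mxE liftK.
Qed.

Lemma vertex_map_face (R : realType) p q (th : 'I_p.+2 -> 'I_q.+1) (i : 'I_p.+2)
    (v : simplex R p) :
  vertex_map th (face i v) = vertex_map (th \o lift i) v.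
Proof.
by apply: val_inj; apply/rowP => k /=; rewrite !mxE sum_face_row.
Qed.

Lemma weight_face (R : realType) p (chi : pred 'I_p.+2) (i : 'I_p.+2)
    (v : simplex R p) :
  weight chi (face i v) = weight (chi \o lift i) v.
Proof. exact: sum_face_row. Qed.

Lemma face_vertex_map (R : realType) p q (th : 'I_p.+1 -> 'I_q.+1) (i : 'I_q.+2)
    (v : simplex R p) :
  face i (vertex_map th v) = vertex_map (lift i \o th) v.
Proof.
apply: val_inj; apply/rowP => k /=; rewrite !mxE.
case: unliftP => [k' ->|->].
  by rewrite mxE; apply: eq_bigl => j /=; rewrite (inj_eq lift_inj).
by rewrite big_pred0 // => j /=; apply/negbTE; rewrite eq_sym neq_lift.
Qed.

(** * The prism operator *)

Section Prism.
Variables (R : realType) (X Y : topologicalType) (D : continuousType (X * R)%type Y).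

(* The affine map of [p]-simplices sending the [j]-th vertex to the vertex
   [th j] of [s] at height [chi j]. *)
Definition prism_map q p (s : singular_simplex R X q) (th : 'I_p.+1 -> 'I_q.+1)
  (chi : pred 'I_p.+1) (v : simplex R p) : Y := D (s (vertex_map th v), weight chi v).

Lemma prism_map_continuous q p (s : singular_simplex R X q)
  (th : 'I_p.+1 -> 'I_q.+1) (chi : pred 'I_p.+1) : continuous (prism_map s th chi).
Proof.
apply: (continuous_compT (Y := (X * R)%type)); last exact: cts_fun.
apply: continuous_pairT; last exact: weight_continuous.
exact: (continuous_compT (@vertex_map_continuous _ _ _ _) cts_fun).
Qed.

HB.instance Definition _ q p s th chi := isContinuous.Build _ _
  (@prism_map q p s th chi) (@prism_map_continuous q p s th chi).

Definition prism_simplex q p (s : singular_simplex R X q)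
  (th : 'I_p.+1 -> 'I_q.+1) (chi : pred 'I_p.+1) : singular_simplex R Y p :=
  [the continuousType _ _ of prism_map s th chi].

Lemma prism_simplex_ext q p (s : singular_simplex R X q)
    (th th' : 'I_p.+1 -> 'I_q.+1) (chi chi' : pred 'I_p.+1) :
  th =1 th' -> chi =1 chi' -> prism_simplex s th chi = prism_simplex s th' chi'.
Proof. by move=> /funext -> /funext ->. Qed.

Lemma face_prism_simplex q p (s : singular_simplex R X q)
    (th : 'I_p.+2 -> 'I_q.+1) (chi : pred 'I_p.+2) (i : 'I_p.+2) :
  singular_face i (prism_simplex s th chi) =
  prism_simplex s (th \o lift i) (chi \o lift i).
Proof.
apply/continuousEP => v.
by rewrite /= /prism_map vertex_map_face weight_face.
Qed.

Lemma prism_simplex_face q p (s : singular_simplex R X q.+1)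
    (th : 'I_p.+1 -> 'I_q.+1) (chi : pred 'I_p.+1) (i : 'I_q.+2) :
  prism_simplex (singular_face i s) th chi = prism_simplex s (lift i \o th) chi.
Proof. by apply/continuousEP => v; rewrite /= /prism_map /= face_vertex_map. Qed.

(** The degeneracy hitting [i] twice: with heights [i < j], the vertices [0..i] lie on the bottom of
    the prism and [i..q] on the top. The index [i] is a natural number so that sums over prisms and
    faces can be reindexed freely. *)
Definition collapse q (i : nat) (j : 'I_q.+2) : 'I_q.+1 := inord (unbump i j).

Definition prism_op q (c : cochain R Y q.+1) : cochain R X q := fun s =>
  \sum_(i < q.+1) (-1) ^+ i * c (prism_simplex s (@collapse q i) (fun j => (i < j)%N)).

End Prism.

(* The terms off the diagonal cancel, those on it telescope. *)
Lemma prism_sum (q : nat) (a b : nat -> nat -> int) :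
  (forall i j, (j < i <= q)%N -> a j i = b j i.-1) ->
  (forall i j, (i.+1 < j <= q.+1)%N -> a j i = b j.-1 i) ->
  (forall i, (i < q)%N -> a i.+1 i.+1 = a i.+1 i) ->
  \sum_(i < q.+1) (-1) ^+ i * \sum_(j < q.+2) (-1) ^+ j * a j i =
  a 0 0 - a q.+1 q - \sum_(j < q.+1) (-1) ^+ j * \sum_(i < q) (-1) ^+ i * b j i.
Proof.
move=> alt agt adiag.
pose F j i := (-1) ^+ (i + j) * a j i; pose G j i := (-1) ^+ (i + j) * b j i.
have -> : \sum_(i < q.+1) (-1) ^+ i * \sum_(j < q.+2) (-1) ^+ j * a j i =
   \sum_(i < q.+1) (F i i + F i.+1 i) +
   (\sum_(i < q.+1) \sum_(j < q.+2 | (j < i)%N) F j i +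
   \sum_(i < q.+1) \sum_(j < q.+2 | (i.+1 < j)%N) F j i).
  rewrite -!big_split /=; apply: eq_bigr => i _; rewrite mulr_sumr.
  rewrite [LHS](_ : _ = \sum_(j < q.+2) F j i); last first.
    by apply: eq_bigr => j _; rewrite mulrA -exprD.
  rewrite (bigID (fun j : 'I__ => (j < i)%N)) /= [RHS]addrCA; congr (_ + _).
  have iq := ltn_ord i.
  have i1q : (i < q.+2)%N by lia.
  rewrite (bigD1 (Ordinal i1q)) /=; last by rewrite ltnn.
  rewrite (bigD1 (lift ord0 i)) /=; last by rewrite -val_eqE /= /bump; lia.
  rewrite addrA; congr (_ + _).
  apply: eq_bigl => j; rewrite -!val_eqE /= /bump; lia.
have -> : \sum_(i < q.+1) (F i i + F i.+1 i) = a 0 0 - a q.+1 q.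
  have Fd i : F i i = a i i by rewrite /F addnn -signr_odd odd_double mul1r.
  have Fs i : F i.+1 i = - a i.+1 i.
    by rewrite /F addnS addnn exprS -signr_odd odd_double mulr1 mulN1r.
  rewrite big_split big_ord_recl big_ord_recr /= Fd Fs -!addrA; congr (_ + _).
  rewrite addrA -big_split /= big1 ?add0r // => i _.
  by rewrite Fd Fs /bump /= adiag ?subrr.
congr (_ + _).
have -> : \sum_(j < q.+1) (-1) ^+ j * \sum_(i < q) (-1) ^+ i * b j i =
    \sum_(i < q) \sum_(j < q.+1) G j i.
  rewrite exchange_big; apply: eq_bigr => j _; rewrite mulr_sumr.
  by apply: eq_bigr => i _; rewrite mulrA -exprD addnC.
(* Shifting [i] by one in this family, and [j] by one in the next, turns them into the complementary
   halves [j <= i] and [j > i] of the same double sum, each at the cost of a sign. *)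
have -> : \sum_(i < q.+1) \sum_(j < q.+2 | (j < i)%N) F j i =
    - \sum_(i < q) \sum_(j < q.+1 | (j <= i)%N) G j i.
  rewrite big_ord_recl big_pred0 // add0r -sumrN; apply: eq_bigr => i _.
  rewrite -sumrN big_mkcond big_ord_recr /= ifF ?addr0; last first.
    by have := ltn_ord i; rewrite /bump; lia.
  rewrite [RHS]big_mkcond; apply: eq_bigr => j _; rewrite /= /bump /= add1n ltnS.
  case: ifP => // ji; rewrite /F /G alt; last by have := ltn_ord i; lia.
  by rewrite addSn exprS mulN1r mulNr.
have -> : \sum_(i < q.+1) \sum_(j < q.+2 | (i.+1 < j)%N) F j i =
    - \sum_(i < q) \sum_(j < q.+1 | ~~ (j <= i)%N) G j i.
  rewrite big_ord_recr /= addrC big_pred0 ?add0r; last first.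
    by move=> j; have := ltn_ord j; lia.
  rewrite -sumrN; apply: eq_bigr => i _.
  rewrite -sumrN big_mkcond big_ord_recl /= add0r.
  rewrite [RHS]big_mkcond; apply: eq_bigr => j _; rewrite /= /bump /= add1n ltnS -ltnNge.
  case: ifP => // ji; rewrite /F /G agt; last by have := ltn_ord j; lia.
  by rewrite addnS exprS mulN1r mulNr.
rewrite -opprD -big_split; congr (- _); apply: eq_bigr => i _.
by rewrite [RHS](bigID (fun j : 'I__ => (j <= i)%N)).
Qed.

Lemma collapse_val q (i : nat) (j : 'I_q.+2) :
  (i <= q)%N -> collapse i j = unbump i j :> nat.
Proof.
move=> iq; rewrite /collapse inordK // /unbump; have := ltn_ord j; lia.
Qed.

Section PrismHomotopy.
Variables (R : realType) (X Y : topologicalType) (f g : continuousType X Y)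
  (D : continuousType (X * R)%type Y).
Hypotheses (D0 : forall x, D (x, 0) = f x) (D1 : forall x, D (x, 1) = g x).

(** The table [b] holds the values of [c] on the prisms over the faces of [s]. Keeping it abstract
    covers degree 0, where the inner sums are empty, together with positive degrees, where the
    double sum becomes the coboundary of [prism_op D c]. *)
Lemma prism_op_coboundary_sum q (c : cochain R Y q) (s : singular_simplex R X q)
    (b : nat -> nat -> int) :
  (forall i j, (j < q.+1)%N -> (i < q)%N -> forall th chi,
     th =1 (fun k : 'I_q.+1 => inord (bump j (unbump i k))) ->
     chi =1 (fun k : 'I_q.+1 => (i < k)%N) ->
     c (prism_simplex D s th chi) = b j i) ->
  prism_op D (coboundary c) s =
  c [the continuousType _ _ of g \o s] - c [the continuousType _ _ of f \o s] -
  \sum_(j < q.+1) (-1) ^+ j * \sum_(i < q) (-1) ^+ i * b j i.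
Proof.
move=> bE.
pose a j i := c (singular_face (inord j)
  (prism_simplex D s (@collapse q i) (fun j => (i < j)%N))).
have aE j i th chi : (i <= q)%N -> (j <= q.+1)%N ->
    th =1 (fun k : 'I_q.+1 => inord (unbump i (bump j k))) ->
    chi =1 (fun k : 'I_q.+1 => (i < bump j k)%N) ->
    a j i = c (prism_simplex D s th chi).
  move=> iq jq thE chiE; rewrite /a face_prism_simplex; congr c.
  apply: prism_simplex_ext => k; rewrite ?thE ?chiE /= ?inordK //.
  by rewrite /collapse /= inordK.
transitivity (a 0 0 - a q.+1 q -
    \sum_(j < q.+1) (-1) ^+ j * \sum_(i < q) (-1) ^+ i * b j i); last first.
  congr (_ - _ - _).
    rewrite (@aE _ _ id xpredT) // => [|k].
    - congr c; apply/continuousEP => v.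
      by rewrite /= /prism_map weight_predT vertex_map_id D1.
    - have := ltn_ord k => kq; apply: val_inj.
      by rewrite /= inordK // /unbump /bump; lia.
  rewrite (@aE _ _ id xpred0) // => [|k|k].
  - congr c; apply/continuousEP => v.
    by rewrite /= /prism_map weight_pred0 vertex_map_id D0.
  - have := ltn_ord k => kq; apply: val_inj.
    by rewrite /= inordK // /unbump /bump; lia.
  - by have := ltn_ord k; rewrite /bump; lia.
rewrite -prism_sum => [||i j ij|i iq].
- apply: eq_bigr => i _; congr (_ * _); apply: eq_bigr => j _; congr (_ * _).
  by rewrite /a inord_val.
- move=> i j ij; rewrite (@aE _ _
    (fun k : 'I_q.+1 => inord (bump j (unbump i.-1 k))) (fun k => (i.-1 < k)%N))
    => [|||k|k]; [|lia|lia| |].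
  + by apply: bE => //; lia.
  + by congr inord; rewrite /bump /unbump; lia.
  + by rewrite /bump; lia.
- rewrite (@aE _ _
    (fun k : 'I_q.+1 => inord (bump j.-1 (unbump i k))) (fun k => (i < k)%N))
    => [|||k|k]; [|lia|lia| |].
  + by apply: bE => //; lia.
  + by congr inord; rewrite /bump /unbump; lia.
  + by rewrite /bump; lia.
(* Consecutive simplices of the prism share a face: dropping vertex [i.+1] removes the last bottom
   vertex of one and the first top vertex of the other. *)
rewrite (@aE i.+1 i (fun k : 'I_q.+1 => inord (unbump i.+1 (bump i.+1 k)))
   (fun k => (i.+1 < bump i.+1 k)%N)) => [|||k|k]; [|lia|lia| |].
- by apply: aE => //; lia.
- by congr inord; rewrite /bump /unbump; lia.
- by rewrite /bump; lia.
Qed.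

Lemma prism_homotopy0 (c : cochain R Y 0) :
  prism_op D (coboundary c) = cochain_map g c - cochain_map f c.
Proof.
apply/funext => s; rewrite (@prism_op_coboundary_sum _ _ _ (fun _ _ => 0)) //.
by rewrite big1 ?subr0 // => j _; rewrite big_ord0 mulr0.
Qed.

Lemma prism_homotopy q (c : cochain R Y q.+1) :
  coboundary (prism_op D c) + prism_op D (coboundary c) =
  cochain_map g c - cochain_map f c.
Proof.
apply/funext => s; rewrite -[LHS]/(coboundary (prism_op D c) s + prism_op D (coboundary c) s).
rewrite (@prism_op_coboundary_sum _ _ _ (fun j i => c (prism_simplex D
  (singular_face (inord j) s) (@collapse q i) (fun j => (i < j)%N)))).
  rewrite addrC -[RHS](subrK (coboundary (prism_op D c) s)); congr (_ - _ + _).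
  by apply: eq_bigr => j _; rewrite inord_val.
move=> i j jq iq th chi thE chiE; rewrite prism_simplex_face; congr c.
apply: prism_simplex_ext => // k; rewrite thE /=.
apply: val_inj; rewrite /= collapse_val // inordK; last first.
  by have := ltn_ord k; rewrite /bump /unbump; lia.
by rewrite inordK.
Qed.

(** On a cocycle the prism formula exhibits the difference of the two pullbacks as a coboundary; in
    degree 0 it makes the difference vanish outright. *)
Lemma homotopic_cohomology_map q : cohomology_map R f q =1 cohomology_map R g q.
Proof.
move=> h; apply/esym/cohomology_classP; set z := repr h.
have /asboolP dz := cocycleP z; rewrite raddfB /=.
case: q h z dz => [|q] h z dz /=.
  by rewrite -prism_homotopy0 dz; apply/funext => s; apply: big1 => i _; exact: mulr0.
exists (prism_op D (val z)) => //; rewrite -prism_homotopy dz.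
rewrite [prism_op D 0](_ : _ = 0) ?addr0 //.
by apply/funext => s; apply: big1 => i _; exact: mulr0.
Qed.

End PrismHomotopy.

Lemma cohomology_map_id (R : realType) (X : topologicalType)
    (f : continuousType X X) q :
  f =1 id -> cohomology_map R f q =1 id.
Proof.
move=> f1 h; rewrite -[RHS]reprK -/(cohomology_class _).
congr cohomology_class; apply: val_inj; apply/funext => s /=.
by congr (val (repr h) _); apply/continuousEP => v; exact: f1.
Qed.

Lemma cohomology_map_comp (R : realType) (X Y Z : topologicalType)
    (f : continuousType X Y) (g : continuousType Y Z) q :
  cohomology_map R [the continuousType X Z of g \o f] q =1
  cohomology_map R f q \o cohomology_map R g q.
Proof.
move=> h; rewrite -[h]reprK -/(cohomology_class _) /= !cohomology_mapE.
congr cohomology_class; apply: val_inj; apply/funext => s /=.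
by congr (val (repr h) _); apply/continuousEP.
Qed.

Lemma homotopy_equivalence_cohomology (R : realType) (X Y : topologicalType)
    (f : continuousType X Y) (g : continuousType Y X)
    (D : continuousType (X * R)%type X) (E : continuousType (Y * R)%type Y) q :
  (forall x, D (x, 0) = g (f x)) -> (forall x, D (x, 1) = x) ->
  (forall y, E (y, 0) = f (g y)) -> (forall y, E (y, 1) = y) ->
  bijective (cohomology_map R f q).
Proof.
move=> D0 D1 E0 E1; exists (cohomology_map R g q) => h.
  rewrite -[LHS](cohomology_map_comp g f).
  rewrite -[RHS](@cohomology_map_id R Y [the continuousType Y Y of idfun] q) //.
  exact: (@homotopic_cohomology_map R Y Y _ _ E).
rewrite -[LHS](cohomology_map_comp f g).
rewrite -[RHS](@cohomology_map_id R X [the continuousType X X of idfun] q) //.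
exact: (@homotopic_cohomology_map R X X _ _ D).
Qed.

(** * Sliding a 2-cell *)

Section OpenCells.
Variable R : realType.
Local Notation I := (unit_interval R).

Lemma open_intervalP (u : open_interval R) : 0 < val u < 1.
Proof. by case: u => u /= /set_mem /=; rewrite in_itv. Qed.

Lemma open_interval_clamp (u : open_interval R) : val (clamp (val u)) = val u.
Proof. by rewrite clamp_id //; have /andP[/ltW -> /ltW ->] := open_intervalP u. Qed.

Lemma unit_interval_cases (t : I) :
  [\/ t = zero, t = one | exists u : open_interval R, t = clamp (val u)].
Proof.
have /andP[t0 t1] := unit_intervalP t.
have [t0'|t0'] := eqVneq (val t) 0.
  by constructor 1; apply: val_inj; rewrite val_zero.
have [t1'|t1'] := eqVneq (val t) 1.
  by constructor 2; apply: val_inj; rewrite val_one.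
have tP : val t \in (`]0, 1[%classic : set R).
  by rewrite inE /= in_itv /= !lt_neqAle t0 t1 eq_sym t0' t1'.
by constructor 3; exists (exist (fun y => is_true (y \in `]0, 1[%classic)) _ tP); rewrite clampK.
Qed.

Variables (n m : nat) (P : presentation n m).
Local Notation K := (pres_complex R P).

Lemma char_map1_cell i (u : open_interval R) :
  char_map1 P i (clamp (val u)) = Cell1 i u.
Proof. by rewrite /char_map1 open_interval_clamp valK. Qed.

Lemma char_map2_cell k (u v : open_interval R) :
  char_map2 P k (clamp (val u), clamp (val v)) = Cell2 k u v.
Proof. by rewrite /char_map2 [(_, _).1]/= [(_, _).2]/= !open_interval_clamp !valK. Qed.

Lemma char_map2_bottom k (s : I) : char_map2 P k (s, zero) = word_map P (P k) s.
Proof. by rewrite /char_map2 insub_interval_zero val_zero eqxx; case: insub. Qed.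

Lemma char_map2_top k (s : I) : char_map2 P k (s, one) = Cell0.
Proof. by rewrite /char_map2 insub_interval_one val_one oner_eq0; case: insub. Qed.

Lemma char_map2_left k (t : I) : char_map2 P k (zero, t) = Cell0.
Proof.
by rewrite /char_map2 insub_interval_zero; case: ifP => // _; exact: word_map_zero.
Qed.

Lemma char_map2_right k (t : I) : char_map2 P k (one, t) = Cell0.
Proof.
by rewrite /char_map2 insub_interval_one; case: ifP => // _; exact: word_map_one.
Qed.

Lemma pres_complex_continuous (X : topologicalType) (F : K -> X) :
  (forall i, continuous (fun t : I => F (char_map1 P i t))) ->
  (forall k, continuous (fun z : I * I => F (char_map2 P k z))) ->
  continuous F.
Proof.
move=> c1 c2; apply/continuousP => U oU; split=> [i|k].
- by move/continuousP: (c1 i); apply.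
- by move/continuousP: (c2 k); apply.
Qed.

Import ArrowAsCompactOpen.

(* A product with the locally compact line preserves the weak topology: curry
   into the compact-open topology. *)
Lemma pres_complex_continuous_homotopy (X : topologicalType) (D : K -> R -> X) :
  continuous (D Cell0) ->
  (forall i, continuous (fun z : I * R => D (char_map1 P i z.1) z.2)) ->
  (forall k, continuous (fun z : (I * I) * R => D (char_map2 P k z.1) z.2)) ->
  continuous (fun z : K * R => D z.1 z.2).
Proof.
move=> c0 c1 c2; rewrite [X in continuous X](_ : _ = uncurry D); last first.
  by apply/funext => -[].
apply: (@continuous_uncurry K R X D).
- exact: locally_compactR.
- exact: Rhausdorff.
- apply: pres_complex_continuous => [i|k].
    exact: (continuous_curry_fun (c1 i)).
  exact: (continuous_curry_fun (c2 k)).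
(* Every point is the 0-cell or a value of a characteristic map, so its time slice is continuous by
   one of the three hypotheses. *)
- case=> [//|i u|k u v].
    by have [_ /(_ (clamp (val u)))] := continuous_curry (c1 i); rewrite /curry /= char_map1_cell.
  have [_ /(_ (clamp (val u), clamp (val v)))] := continuous_curry (c2 k).
  by rewrite /curry /= char_map2_cell.
Qed.

End OpenCells.

Section OneSkeleton.
Variables (R : realType) (n m m' : nat).
Variables (P : presentation n m) (P' : presentation n m').
Variable F : pres_complex R P -> pres_complex R P'.
Hypotheses (F0 : F Cell0 = Cell0) (F1 : forall i u, F (Cell1 i u) = Cell1 i u).

Lemma fix_char_map1 i t : F (char_map1 P i t) = char_map1 P' i t.
Proof. by rewrite /char_map1; case: insub => [u|]; rewrite ?F0 ?F1. Qed.

(** Words are read in the 1-skeleton, which both complexes share and [F] fixes. This gives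
    compatibility with attaching loops and, later, identifies the effect of a slide on fundamental
    groups. *)
Lemma fix_word_map w t : F (word_map P w t) = word_map P' w t.
Proof.
elim: w t => [|a w IH] t //=; rewrite /path_cat; case: ifP => // _.
by rewrite /letter_map; case: a.2; rewrite /path_rev fix_char_map1.
Qed.

End OneSkeleton.

(** * Collar of the [k]-th cell and slides along it *)

Section Slide.
Variables (R : realType) (n m : nat) (k : 'I_m).
Variable P0 : presentation n m.-1.
Local Notation I := (unit_interval R).

Section Inclusion.
Variables (P : presentation n m) (hP : forall l, P (lift k l) = P0 l).

(** As [P0] omits the [k]-th relator, its complex is the complement of the open [k]-th cell;
    [lift k] renumbers the remaining cells. *)
Definition pres_incl (x : pres_complex R P0) : pres_complex R P :=
  match x with
  | Cell0 => Cell0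
  | Cell1 i u => Cell1 i u
  | Cell2 l u v => Cell2 (lift k l) u v
  end.

Lemma pres_incl_word_map w t : pres_incl (word_map P0 w t) = word_map P w t.
Proof. exact: fix_word_map. Qed.

Lemma pres_incl_char_map2 l z :
  pres_incl (char_map2 P0 l z) = char_map2 P (lift k l) z.
Proof.
rewrite /char_map2; case: insub => [u|]; first case: insub => [//|].
  by case: ifP => // _; rewrite hP; exact: pres_incl_word_map.
by case: ifP => // _; rewrite hP; exact: pres_incl_word_map.
Qed.

Lemma pres_incl_continuous : continuous pres_incl.
Proof.
apply: pres_complex_continuous => [i|l].
  under eq_fun do rewrite fix_char_map1 //; exact: char_map1_continuous.
under eq_fun do rewrite pres_incl_char_map2; exact: char_map2_continuous.
Qed.

Variable H : I * I -> pres_complex R P0.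

(* The [k]-th closed 2-cell of [P], extended below its attaching loop by the
   homotopy [H]. *)
Definition collar (u : I) (y : R) : pres_complex R P :=
  if y <= 0 then pres_incl (H (u, clamp (1 + y))) else char_map2 P k (u, clamp y).

Hypotheses (cH : continuous H) (H1 : forall u, H (u, one) = word_map P0 (P k) u)
  (Hl : forall s, H (zero, s) = Cell0) (Hr : forall s, H (one, s) = Cell0).

Lemma collar_continuous : continuous (fun z : I * R => collar z.1 z.2).
Proof.
apply: (@continuous_ifle R _ _ snd (fun=> 0)).
- exact: continuous_sndT.
- by move=> t; exact: cvg_cst.
- apply: (@continuous_compT _ _ _ (fun z : I * R => (z.1, clamp (1 + z.2)))
    (fun w => pres_incl (H w))); last first.
    exact: (continuous_compT cH pres_incl_continuous).
  apply: continuous_pairT; first exact: continuous_fstT.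
  apply: (continuous_compT _ (@continuous_clamp R)) => t.
  by apply: cvgD; [exact: cvg_cst|exact: cvg_snd].
- apply: (@continuous_compT _ _ _ (fun z : I * R => (z.1, clamp z.2))
    (char_map2 P k)); last exact: char_map2_continuous.
  apply: continuous_pairT; first exact: continuous_fstT.
  exact: (continuous_compT (@continuous_sndT _ _) (@continuous_clamp R)).
- move=> [u y] /= ->; rewrite addr0 (clamp_ge1 (lexx 1)) (clamp_le0 (lexx 0)).
  by rewrite H1 pres_incl_word_map char_map2_bottom.
Qed.

Lemma collar_comp_continuous (T : topologicalType) (f : T -> I) (g : T -> R) :
  continuous f -> continuous g -> continuous (fun t => collar (f t) (g t)).
Proof.
by move=> cf cg; exact: (continuous_compT (continuous_pairT cf cg) collar_continuous).
Qed.

Lemma collar_left y : collar zero y = Cell0.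
Proof. by rewrite /collar Hl char_map2_left if_same. Qed.

Lemma collar_right y : collar one y = Cell0.
Proof. by rewrite /collar Hr char_map2_right if_same. Qed.

Lemma collar1 u : collar u 1 = Cell0.
Proof. by rewrite /collar ler10 clamp_ge1 // char_map2_top. Qed.

Lemma collar_ge0 u y : 0 <= y -> collar u y = char_map2 P k (u, clamp y).
Proof.
rewrite le_eqVlt => /predU1P[<-|y0]; last by rewrite /collar leNgt y0.
rewrite /collar lexx addr0 (clamp_ge1 (lexx 1)) (clamp_le0 (lexx 0)).
by rewrite H1 pres_incl_word_map char_map2_bottom.
Qed.

(** One formula covers all maps needed: [slide_up] as [phi] gives a slide, [slide_fold] a composite
    of two opposite slides, and the identity gives the identity map when [P'] is [P]. Deforming
    [phi] thus deforms the map. *)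
Definition collar_map (P' : presentation n m) (phi : R -> R)
    (x : pres_complex R P') : pres_complex R P :=
  match x with
  | Cell0 => Cell0
  | Cell1 i u => Cell1 i u
  | Cell2 l u v => if l == k then collar (clamp (val u)) (phi (val v)) else Cell2 l u v
  end.

Section CollarMap.
Variables (P' : presentation n m) (hP' : forall l, P' (lift k l) = P0 l).
Variable phi : R -> R.
Hypotheses (phi0 : forall u, collar u (phi 0) = word_map P (P' k) u) (phi1 : phi 1 = 1).

(** The map is defined on open cells, so its formula has to be checked on the boundary of the
    square: [phi0] handles the bottom, [phi1] the top, and the sides of the collar are collapsed to
    the 0-cell. *)
Lemma collar_map_char_map2 z :
  collar_map phi (char_map2 P' k z) = collar z.1 (phi (val z.2)).
Proof.
case: z => s t /=.
have [->|->|[v ->]] := unit_interval_cases t.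
- by rewrite char_map2_bottom val_zero phi0; exact: fix_word_map.
- by rewrite char_map2_top val_one phi1 collar1.
have [->|->|[u ->]] := unit_interval_cases s.
- by rewrite char_map2_left collar_left.
- by rewrite char_map2_right collar_right.
by rewrite char_map2_cell open_interval_clamp /= eqxx.
Qed.

Lemma collar_map_char_map2_neq l z : l != k ->
  collar_map phi (char_map2 P' l z) = char_map2 P l z.
Proof.
move=> lk; have [j lE|lE] := unliftP k l; last by rewrite lE eqxx in lk.
rewrite /char_map2; case: insub => [u|]; first case: insub => [v|] /=.
- by rewrite (negbTE lk).
- by case: ifP => // _; rewrite lE hP hP'; exact: fix_word_map.
- by case: ifP => // _; rewrite lE hP hP'; exact: fix_word_map.
Qed.

Lemma collar_map_continuous : continuous phi ->
  continuous (collar_map phi : pres_complex R P' -> _).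
Proof.
move=> cphi; apply: pres_complex_continuous => [i|l].
  under eq_fun do rewrite fix_char_map1 //; exact: char_map1_continuous.
have [->|lk] := eqVneq l k.
  under eq_fun do rewrite collar_map_char_map2.
  apply: collar_comp_continuous; first exact: continuous_fstT.
  apply: continuous_compT cphi.
  exact: (continuous_compT (@continuous_sndT _ _) (@continuous_val R)).
under eq_fun do rewrite collar_map_char_map2_neq //.
exact: char_map2_continuous.
Qed.

End CollarMap.

Lemma collar_map_id (phi : R -> R) (x : pres_complex R P) :
  (forall y, phi y = y) -> collar_map phi x = x.
Proof.
move=> phiE; case: x => //= l u v; case: eqP => // ->.
rewrite phiE collar_ge0; last by have /andP[/ltW] := open_intervalP v.
exact: char_map2_cell.
Qed.

(** Since 0 and 1 are fixed at every time, each stage respects the attaching loop of the [k]-th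
    cell, so the collar formula holds on the closed cell throughout. *)
Lemma collar_homotopy_continuous (phi : R * R -> R) :
  continuous phi -> (forall y, phi (y, 0) = 0) -> (forall y, phi (y, 1) = 1) ->
  continuous (fun z : pres_complex R P * R => collar_map (fun v => phi (z.2, v)) z.1).
Proof.
move=> cphi phi0 phi1.
apply: (@pres_complex_continuous_homotopy R n m P _
  (fun x y => collar_map (fun v => phi (y, v)) x)) => [|i|l] /=.
- exact: (@cst_continuous _ _ Cell0).
- under eq_fun do rewrite fix_char_map1 //.
  exact: (continuous_compT (@continuous_fstT _ _) (@char_map1_continuous _ _ _ P i)).
have [->|lk] := eqVneq l k.
  under eq_fun => z.
    rewrite collar_map_char_map2 //; last first.
      by move=> u; rewrite phi0 collar_ge0 // (clamp_le0 (lexx 0)) char_map2_bottom.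
    over.
  apply: collar_comp_continuous.
    exact: (continuous_compT (@continuous_fstT _ _) (@continuous_fstT _ _)).
  apply: (continuous_compT _ cphi).
  apply: continuous_pairT; first exact: continuous_sndT.
  apply: (continuous_compT _ (@continuous_val R)).
  exact: (continuous_compT (@continuous_fstT _ _) (@continuous_sndT _ _)).
under eq_fun do rewrite collar_map_char_map2_neq //.
exact: (continuous_compT (@continuous_fstT _ _) (@char_map2_continuous _ _ _ P l)).
Qed.

End Inclusion.

(** This stretches [[0, 1]] onto [[-1, 1]]: the lower half of the cell sweeps out the homotopy [H],
    the upper half covers the target cell. *)
Definition slide_up (v : R) : R := 2 * v - 1.

(* Composing two opposite slides sends the [k]-th cell once through the collar
   and back before covering it, see [slide_map_flip]. *)
Definition slide_fold (v : R) : R := if v <= 2^-1 then - 2 * v else 4 * v - 3.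

Definition flip (X : Type) (H : I * I -> X) (z : I * I) : X :=
  H (z.1, clamp (1 - val z.2)).

Lemma flipE (X : Type) (H : I * I -> X) u t :
  flip H (u, t) = H (u, clamp (1 - val t)).
Proof. by []. Qed.

Lemma flipK (X : Type) (H : I * I -> X) : flip (flip H) = H.
Proof.
apply/funext => -[u t]; have /andP[t0 t1] := unit_intervalP t.
rewrite !flipE clamp_id; last lra.
by rewrite opprB addrC subrK clampK.
Qed.

Lemma flip_zero (X : Type) (H : I * I -> X) u : flip H (u, zero) = H (u, one).
Proof. by rewrite /flip val_zero subr0 clamp_ge1. Qed.

Lemma flip_one (X : Type) (H : I * I -> X) u : flip H (u, one) = H (u, zero).
Proof. by rewrite /flip val_one subrr clamp_le0. Qed.

Lemma flip_continuous (X : topologicalType) (H : I * I -> X) :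
  continuous H -> continuous (flip H).
Proof.
move=> cH; apply: (@continuous_compT _ _ _ (fun z : I * I => (z.1, clamp (1 - val z.2))) H) => //.
apply: continuous_pairT; first exact: continuous_fstT.
apply: (continuous_compT _ (@continuous_clamp R)) => z.
apply: cvgB; first exact: cvg_cst.
exact: (continuous_compT (@continuous_sndT _ _) (@continuous_val R)).
Qed.

Lemma slide_up_continuous : continuous slide_up.
Proof. by apply: (@continuous_lin R R id 2 (-1)) => x; exact: cvg_id. Qed.

Lemma slide_fold_continuous : continuous slide_fold.
Proof.
apply: (@continuous_ifle R R R id (fun=> 2^-1)).
- by move=> x; exact: cvg_id.
- by move=> x; exact: cvg_cst.
- by move=> x; apply: cvgMr; exact: cvg_id.
- by apply: (@continuous_lin R R id 4 (-3)) => x; exact: cvg_id.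
- by move=> t /= ->; lra.
Qed.

Record slide_homotopy (P P' : presentation n m) (H : I * I -> pres_complex R P0) : Prop :=
  SlideHomotopy {
    slide_continuous : continuous H;
    slide_zero : forall u, H (u, zero) = word_map P0 (P' k) u;
    slide_one : forall u, H (u, one) = word_map P0 (P k) u;
    slide_left : forall s, H (zero, s) = Cell0;
    slide_right : forall s, H (one, s) = Cell0 }.

Lemma slide_homotopy_flip P P' H : slide_homotopy P P' H -> slide_homotopy P' P (flip H).
Proof.
move=> [cH H0 H1 Hl Hr]; split=> [|u|u|s|s].
- exact: flip_continuous.
- by rewrite flip_zero.
- by rewrite flip_one.
- exact: Hl.
- exact: Hr.
Qed.

Definition slide_map (P P' : presentation n m) H :
    pres_complex R P' -> pres_complex R P :=
  collar_map P H slide_up.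

Section SlideMap.
Variables (P P' : presentation n m).
Hypotheses (hP : forall l, P (lift k l) = P0 l) (hP' : forall l, P' (lift k l) = P0 l).
Variable H : I * I -> pres_complex R P0.
Hypothesis HP : slide_homotopy P P' H.

Lemma slide_map_continuous :
  continuous (slide_map P H : pres_complex R P' -> pres_complex R P).
Proof.
have [cH H0 H1 Hl Hr] := HP; apply: (collar_map_continuous hP) => //.
- move=> u; rewrite /slide_up mulr0 add0r /collar lerN10 subrr.
  by rewrite clamp_le0 // H0 pres_incl_word_map.
- by rewrite /slide_up; lra.
- exact: slide_up_continuous.
Qed.

Lemma slide_map_collar (u : I) (v : R) : 0 <= v <= 1 ->
  slide_map P H (collar P' (flip H) u (slide_up v)) = collar P H u (slide_fold v).
Proof.
have [cH H0 H1 Hl Hr] := HP => /andP[v0 v1].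
(* In the lower half the first slide lands in the complement of the [k]-th cell, which the second
   slide fixes; time reversal turns height [2v - 1] into [-2v]. *)
rewrite /slide_fold /slide_up; case: leP => v2.
  rewrite /collar !ifT; [|lra..].
  rewrite flipE clamp_id; last lra.
  rewrite (_ : 1 - (1 + _) = 1 + - 2 * v); last lra.
  rewrite /slide_map; case: (H _) => //= j a b.
  by rewrite eq_sym (negbTE (neq_lift _ _)).
(* In the upper half the point has height [2v - 1] in the cell of [P'], and a second stretching
   gives [2(2v - 1) - 1 = 4v - 3]. *)
rewrite {1}/collar ifF; last by apply/negbTE; lra.
rewrite /slide_map collar_map_char_map2 //.
- rewrite [(_, _).1]/= [(_, _).2]/= clamp_id; last lra.
  by congr collar; rewrite /slide_up; lra.
- move=> a; rewrite /slide_up mulr0 add0r /collar lerN10 subrr.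
  by rewrite clamp_le0 // H0 pres_incl_word_map.
- by rewrite /slide_up; lra.
Qed.

Lemma slide_map_flip (x : pres_complex R P) :
  slide_map P H (slide_map P' (flip H) x) = collar_map P H slide_fold x.
Proof.
case: x => //= l u v; case: eqP => [_|/eqP lk]; last by rewrite /slide_map /= (negbTE lk).
by apply: slide_map_collar; have /andP[/ltW -> /ltW ->] := open_intervalP v.
Qed.

(** Both [slide_fold] and the identity fix 0 and 1, hence so does the straight line between them.
    The collar makes sense at every real height, which allows all real times. *)
Lemma slide_deformation :
  exists D : continuousType (pres_complex R P * R)%type (pres_complex R P),
  [/\ forall x, D (x, 0) = slide_map P H (slide_map P' (flip H) x),
      forall x, D (x, 1) = x & forall y, D (Cell0, y) = Cell0].
Proof.
have [cH H0 H1 Hl Hr] := HP.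
pose phi (w : R * R) := slide_fold w.2 + w.1 * (w.2 - slide_fold w.2).
have cphi : continuous phi.
  have cf : continuous (fun w : R * R => slide_fold w.2).
    exact: (continuous_compT (@continuous_sndT _ _) slide_fold_continuous).
  move=> w; apply: cvgD; first exact: cf.
  apply: cvgM; first exact: cvg_fst.
  by apply: cvgB; [exact: cvg_snd|exact: cf].
have phi0 y : phi (y, 0) = 0.
  by rewrite /phi /slide_fold /= ifT ?invr_ge0 ?ler0n // mulr0 subrr mulr0 addr0.
have phi1 y : phi (y, 1) = 1.
  rewrite /phi /slide_fold /= ifF; last by apply/negbTE; lra.
  by rewrite (_ : 4 * 1 - 3 = 1 :> R) ?subrr ?mulr0 ?addr0 //; lra.
have cD := collar_homotopy_continuous hP cH H1 Hl Hr cphi phi0 phi1.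
exists [the continuousType _ _ of mkcts cD]; split=> [x|x|//] /=; rewrite /mkcts /=.
  rewrite slide_map_flip; congr collar_map.
  by apply/funext => v; rewrite /phi /= mul0r addr0.
by apply: (collar_map_id H1) => y; rewrite /phi /= mul1r addrC subrK.
Qed.

End SlideMap.

End Slide.

(** * Integer row reduction *)

Section RowReduction.
Variables (m n : nat).
Implicit Types A B : 'M[int]_(m, n).

Definition row_add (k l : 'I_m) (b : bool) A : 'M[int]_(m, n) :=
  \matrix_(i, j) (if i == k then A i j + (-1) ^+ b * A l j else A i j).

Inductive row_reach : 'M[int]_(m, n) -> 'M[int]_(m, n) -> Prop :=
| row_reach_refl A : row_reach A A
| row_reach_step A k l b B :
    l != k -> row_reach (row_add k l b A) B -> row_reach A B.

Lemma row_reach_trans A B C : row_reach A B -> row_reach B C -> row_reach A C.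
Proof.
elim=> // {}A k l b {}B lk _ IH /IH; exact: row_reach_step.
Qed.

(** The pivot column [p] need not be the first nonzero column of row [k]: the zeros below it, up to
    and including column [p], already separate the leading columns. *)
Definition partial_echelon A (r c : nat) : Prop :=
  (forall k : 'I_m, (k < r)%N -> exists2 p : 'I_n, (p < c)%N /\ A k p != 0 &
     forall (l : 'I_m) (j : 'I_n), (k < l)%N -> (j <= p)%N -> A l j = 0) /\
  (forall (k : 'I_m) (j : 'I_n), (r <= k)%N -> (j < c)%N -> A k j = 0).

Lemma partial_echelon_row_add A r c (k l : 'I_m) b :
  (r <= k)%N -> (r <= l)%N -> partial_echelon A r c ->
  partial_echelon (row_add k l b A) r c.
Proof.
move=> rk rl [Ap A0]; split=> [i ir|i j ri jc].
  have [p [pc Aip] Al] := Ap i ir; exists p.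
    by split=> //; rewrite mxE ifF //; apply/negbTE; rewrite -val_eqE /=; lia.
  move=> l' j il' jp; rewrite mxE Al // Al ?mulr0 ?addr0 ?if_same //; lia.
by rewrite mxE !A0 // mulr0 addr0 if_same.
Qed.

Lemma partial_echelon_skip A r (c : 'I_n) :
  (forall k : 'I_m, (r <= k)%N -> A k c = 0) ->
  partial_echelon A r c -> partial_echelon A r c.+1.
Proof.
move=> Ac [Ap A0]; split=> [i ir|k j rk].
  by have [p [pc Aip] Al] := Ap i ir; exists p => //; split=> //; lia.
rewrite ltnS leq_eqVlt => /predU1P[jc|]; last exact: A0.
by rewrite (val_inj jc) Ac.
Qed.

Lemma partial_echelon_pivot A (r : 'I_m) (c : 'I_n) :
  A r c != 0 -> (forall k : 'I_m, (r < k)%N -> A k c = 0) ->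
  partial_echelon A r c -> partial_echelon A r.+1 c.+1.
Proof.
move=> Arc Ac [Ap A0]; split=> [i|k j rk].
  rewrite ltnS leq_eqVlt => /predU1P[/val_inj ->|ir]; last first.
    by have [p [pc Aip] Al] := Ap i ir; exists p => //; split=> //; lia.
  exists c => // l j rl; rewrite leq_eqVlt => /predU1P[/val_inj ->|jc].
    exact: Ac.
  by apply: A0 => //; exact: ltnW.
rewrite ltnS leq_eqVlt => /predU1P[jc|jc]; last by apply: A0 => //; exact: ltnW.
by rewrite (val_inj jc) Ac.
Qed.

(* Euclid's algorithm on column [c], by descent on the sum of the absolute
   values of its entries below row [r]. *)
Lemma partial_echelon_column A r (c : 'I_n) : partial_echelon A r c ->
  exists B r', row_reach A B /\ partial_echelon B r' c.+1.
Proof.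
have [N] := ubnP (\sum_(k < m | (r <= k)%N) `|A k c|)%N.
elim: N A => // N IH A muA AE.
case: (pickP (fun w : 'I_m * 'I_m => [&& (r <= w.1)%N, (r <= w.2)%N, w.2 != w.1,
    A w.2 c != 0 & (`|A w.2 c| <= `|A w.1 c|)%N])) => [[k l] /= /and5P[rk rl lk Al0 Alk]|none].
  (* Subtract when the signs agree and add otherwise; as the entry of row [l] is nonzero and no
     larger in absolute value, the entry of row [k] strictly shrinks. *)
  pose b := (0 <= A k c) == (0 <= A l c).
  have dec : (`|(A k c + (-1) ^+ b * A l c)%R| < `|A k c|)%N.
    by rewrite /b; case: eqP => /=; rewrite ?expr0 ?expr1; lia.
  have [||B [r' [AB BE]]] := IH (row_add k l b A).
  - rewrite -ltnS; apply: leq_trans muA; rewrite ltnS (bigD1 k) // [X in (_ < X)%N](bigD1 k) //=.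
    rewrite -addSn leq_add //; first by rewrite mxE eqxx.
    by apply: leq_sum => i /andP[_ /negbTE ik]; rewrite mxE ik.
  - exact: partial_echelon_row_add.
  by exists B, r'; split=> //; exact: row_reach_step AB.
case: (pickP (fun k : 'I_m => (r <= k)%N && (A k c != 0))) => [k /andP[rk Ak0]|none0]; last first.
  exists A, r; split; first exact: row_reach_refl.
  apply: partial_echelon_skip AE => k rk.
  by have := none0 k; rewrite rk => /negbFE/eqP.
(* Of two nonzero entries one would be at most the other in absolute value, so a reducing pair would
   remain; hence only row [k] is nonzero in this column from row [r] on. *)
have A0 (l : 'I_m) : (r <= l)%N -> l != k -> A l c = 0.
  move=> rl lk; apply/eqP/negPn/negP => Al0.
  have := none (k, l); have := none (l, k).
  by rewrite /= rk rl lk eq_sym lk Al0 Ak0 /=; lia.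
have rm : (r < m)%N by apply: leq_ltn_trans rk _.
pose r0 := Ordinal rm.
have [kr|kr] := eqVneq k r0.
  exists A, r.+1; split; first exact: row_reach_refl.
  apply: (@partial_echelon_pivot A r0) => //; first by rewrite -kr.
  by move=> l rl; apply: A0; [exact: ltnW|rewrite kr -val_eqE /= gtn_eqF].
have Ar0 : A r0 c = 0 by apply: A0; rewrite // eq_sym.
(* Row [r0] has a zero in column [c], so adding row [k] to it copies the pivot up, and subtracting
   the new row [r0] from row [k] clears the old one. *)
exists (row_add k r0 true (row_add r0 k false A)), r.+1; split.
  apply: (@row_reach_step _ r0 k false) => //.
  by apply: (@row_reach_step _ k r0 true); [rewrite eq_sym|exact: row_reach_refl].
apply: (@partial_echelon_pivot _ r0); rewrite /=.
- by rewrite !mxE [r0 == k]eq_sym (negbTE kr) eqxx Ar0 add0r mul1r.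
- move=> l rl; rewrite !mxE; have lr0 : (l == r0) = false by rewrite -val_eqE /= gtn_eqF.
  rewrite lr0 eqxx Ar0 add0r !mul1r; case: eqP => [->|/eqP lk]; first by rewrite mulN1r subrr.
  by apply: A0 => //; exact: ltnW.
- by do 2!apply: partial_echelon_row_add => //.
Qed.

Lemma partial_echelon_row_echelon A r : partial_echelon A r n -> row_echelon A.
Proof.
move=> [Ap A0] k l kl; have [lr|rl] := ltnP l r; [right|left]; last first.
  by apply/rowP => j; rewrite !mxE A0.
have [p [_ Akp] Al] := Ap k (ltn_trans kl lr).
apply: (@leq_ltn_trans p).
  rewrite leqNgt; apply/negP => /(before_find p).
  by rewrite nth_ord_enum Akp.
rewrite ltnNge; apply/negP => lp.
have : has (fun i => A l i != 0) (enum 'I_n).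
  by rewrite has_find size_enum_ord; exact: leq_ltn_trans lp _.
move=> /(nth_find p); set j := nth _ _ _ => /eqP; apply.
apply: Al => //; apply: leq_trans (lp).
rewrite /j /leading_column nth_enum_ord // -/(leading_column A l).
exact: leq_ltn_trans lp _.
Qed.

Lemma row_reach_echelon A : exists2 B, row_reach A B & row_echelon B.
Proof.
have H c : (c <= n)%N -> exists B r, row_reach A B /\ partial_echelon B r c.
  elim: c => [_|c IH cn].
    exists A, 0; split; first exact: row_reach_refl.
    by split.
  have [B [r [AB BE]]] := IH (ltnW cn).
  have [C [r' [BC CE]]] := @partial_echelon_column B r (Ordinal cn) BE.
  by exists C, r'; split=> //; exact: row_reach_trans BC.
have [B [r [AB BE]]] := H n (leqnn n).
by exists B => //; exact: partial_echelon_row_echelon BE.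
Qed.

End RowReduction.

(** * Realizing row operations by presentations *)

Section ExponentSum.
Variable n : nat.
Implicit Types (i : 'I_n) (u v w : word n).

Lemma exponent_sum_cat i u v :
  exponent_sum i (u ++ v) = exponent_sum i u + exponent_sum i v.
Proof. exact: big_cat. Qed.

Lemma exponent_sum_inv i w : exponent_sum i (word_inv w) = - exponent_sum i w.
Proof.
rewrite /exponent_sum /word_inv (perm_big _ (permEl (perm_rev _))) big_map -sumrN.
by apply: eq_bigr => -[j []] _; rewrite /= ?expr0 ?expr1 ?opprK.
Qed.

End ExponentSum.

Lemma word_equiv_relators n m m' (P : presentation n m) (Q : presentation n m') u v :
  (forall l, word_equiv P (Q l) [::]) -> word_equiv Q u v -> word_equiv P u v.
Proof.
move=> QP; elim=> {u v} [u|u v _|u v w _ uv _|u a v|u k v].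
- exact: word_equiv_refl.
- exact: word_equiv_sym.
- exact: word_equiv_trans uv.
- exact: word_equiv_cancel.
- exact: (word_equiv_ctx u v (QP k)).
Qed.

Lemma word_equiv_relator_nil n m (P : presentation n m) l : word_equiv P (P l) [::].
Proof. by have := word_equiv_relator P [::] l [::]; rewrite cats0. Qed.

Section PresMap.
Variables (n m m' : nat) (P : presentation n m) (Q : presentation n m').
Hypothesis QP : forall l, word_equiv P (Q l) [::].

Definition pres_map & (forall l, word_equiv P (Q l) [::]) :=
  fun g : presented_group Q => word_class P (repr g).

Lemma pres_mapE w : pres_map QP (word_class Q w) = word_class P w.
Proof. exact/word_classP/(word_equiv_relators QP)/repr_word_class. Qed.

Lemma pres_mapM : {morph pres_map QP : g h / (g * h)%g}.
Proof.
elim/word_class_ind=> u; elim/word_class_ind=> v.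
by rewrite [X in pres_map _ X]pres_mulE !pres_mapE [RHS]pres_mulE.
Qed.

HB.instance Definition _ := isMultiplicative.Build (presented_group Q)
  (presented_group P) (pres_map QP) pres_mapM.

End PresMap.

(** * Composable maps of presentation complexes *)

Section Domination.
Variable R : realType.

(** The whole conclusion except the echelon condition. It is reflexive and transitive, so row
    operations can be realised one at a time. *)
Definition dominates n' m' (Q : presentation n' m') n m (P : presentation n m) : Prop :=
  exists (f : continuousType (pres_complex R Q) (pres_complex R P))
    (f0 : f Cell0 = Cell0)
    (rho : {multiplicative presented_group Q -> presented_group P}),
    [/\ forall g, group_to_pi1 R (rho g) = pi1_map f0 (group_to_pi1 R g),
        forall h : presented_group P, exists g, rho g = h,
        forall h : fundamental_group R (Cell0 : pres_complex R P),
           exists g, pi1_map f0 g = h &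
        forall q : nat, bijective (cohomology_map R f q)].

Lemma dominates_trans n1 m1 (P1 : presentation n1 m1) n2 m2 (P2 : presentation n2 m2)
    n3 m3 (P3 : presentation n3 m3) :
  dominates P1 P2 -> dominates P2 P3 -> dominates P1 P3.
Proof.
move=> [f [f0 [rho [fE rhoS fS fB]]]] [g [g0 [sig [gE sigS gS gB]]]].
pose h : continuousType (pres_complex R P1) (pres_complex R P3) :=
  [the continuousType _ _ of g \o f].
have h0 : h Cell0 = Cell0 by rewrite /= f0.
have hE a : pi1_map h0 a = pi1_map g0 (pi1_map f0 a).
  elim/loop_class_ind: a => p; rewrite !pi1_mapE.
  exact: loop_class_ext.
exists h, h0, [the {multiplicative _ -> _} of sig \o rho]; split.
- by move=> a; rewrite hE -fE -gE.
- by move=> c; have [b <-] := sigS c; have [a <-] := rhoS b; exists a.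
- by move=> c; have [b <-] := gS c; have [a <-] := fS b; exists a.
- move=> q; apply: eq_bij (bij_comp (fB q) (gB q)) _ _ => c.
  by rewrite (cohomology_map_comp f g).
Qed.

(** Following a loop through a deformation that fixes the base point gives a homotopy rel endpoints.
    The resulting right inverse supplies surjectivity on fundamental groups. *)
Lemma pi1_map_deformation (X Y : topologicalType) (f : continuousType Y X)
    (g : continuousType X Y) (x : X) (y : Y) (fy : f y = x) (gx : g x = y)
    (D : continuousType (X * R)%type X) :
  (forall a, D (a, 0) = f (g a)) -> (forall a, D (a, 1) = a) ->
  (forall t, D (x, t) = x) ->
  forall h : fundamental_group R x, pi1_map fy (pi1_map gx h) = h.
Proof.
move=> D0 D1 Dx; elim/loop_class_ind=> p; rewrite !pi1_mapE; apply/loop_classP.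
exists (fun w => D (p w.1, val w.2)); split=> [|t|t|s|s].
- apply: (continuous_compT _ cts_fun); apply: continuous_pairT.
    exact: (continuous_compT (@continuous_fstT _ _) cts_fun).
  exact: (continuous_compT (@continuous_sndT _ _) (@continuous_val R)).
- by rewrite val_zero D0.
- by rewrite val_one D1.
- by rewrite path_zero Dx.
- by rewrite path_one Dx.
Qed.

Lemma dominates_slide n m (P P' : presentation n m) (k : 'I_m) :
  (forall l, l != k -> P' l = P l) ->
  word_equiv (fun l => P (lift k l)) (P' k) (P k) -> dominates P' P.
Proof.
move=> PP' kE; set P0 := fun l => P (lift k l).
have hP l : P (lift k l) = P0 l by [].
have hP' l : P' (lift k l) = P0 l by rewrite PP' // eq_sym neq_lift.
have P0P l : word_equiv P (P0 l) [::] by exact: word_equiv_relator_nil.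
have P'P l : word_equiv P (P' l) [::].
  have [->|lk] := eqVneq l k; last by rewrite PP' //; exact: word_equiv_relator_nil.
  apply: word_equiv_trans (word_equiv_relator_nil P k).
  exact: (word_equiv_relators P0P kE).
(* The two words agree modulo the other relators alone, so their loops are homotopic already in the
   complex without the [k]-th cell. *)
have /loop_classP[H [cH H0 H1 Hl Hr]] := word_loop_equiv R kE.
have HP : slide_homotopy k P P' H by split.
have HP' := slide_homotopy_flip HP.
have [D [D0 D1 Dx]] := slide_deformation hP HP.
(* The opposite composite is the same statement with [P] and [P'] exchanged and [H] reversed;
   reversing twice restores [H]. *)
have [E [E0 E1 _]] := slide_deformation hP' HP'; rewrite flipK in E0.
pose f : continuousType (pres_complex R P') (pres_complex R P) :=
  [the continuousType _ _ of mkcts (slide_map_continuous hP hP' HP)].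
pose g : continuousType (pres_complex R P) (pres_complex R P') :=
  [the continuousType _ _ of mkcts (slide_map_continuous hP' hP HP')].
have f0 : f Cell0 = Cell0 by [].
have g0 : g Cell0 = Cell0 by [].
exists f, f0, [the {multiplicative _ -> _} of pres_map P'P]; split.
- elim/word_class_ind=> w.
  rewrite [X in group_to_pi1 R X]pres_mapE !group_to_pi1E pi1_mapE.
  by apply: loop_class_ext => t; apply/esym; exact: fix_word_map.
- by elim/word_class_ind=> w; exists (word_class P' w); exact: pres_mapE.
- move=> h; exists (pi1_map g0 h).
  exact: (@pi1_map_deformation _ _ f g _ _ f0 g0 D D0 D1 Dx).
- move=> q; exact: (@homotopy_equivalence_cohomology R _ _ f g E D q E0 E1 D0 D1).
Qed.

Lemma dominates_refl n m (P : presentation n m) : dominates P P.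
Proof.
pose f : continuousType (pres_complex R P) (pres_complex R P) :=
  [the continuousType _ _ of idfun].
have f0 : f Cell0 = Cell0 by [].
have fE g : pi1_map f0 g = g.
  elim/loop_class_ind: g => p; rewrite pi1_mapE; exact: loop_class_ext.
exists f, f0, [the {multiplicative _ -> _} of idfun]; split.
- by move=> g; rewrite fE.
- by move=> h; exists h.
- by move=> h; exists h.
- by move=> q; exists idfun => h; rewrite (@cohomology_map_id R _ f q).
Qed.

Lemma dominates_row_reach n m (P : presentation n m) B :
  row_reach (exponent_matrix P) B ->
  exists2 Q : presentation n m, dominates Q P & exponent_matrix Q = B.
Proof.
move eA : (exponent_matrix P) => A AB.
elim: AB P eA => {A B} [A P <-|A k l b B lk _ IH P eA].
  by exists P => //; exact: dominates_refl.
pose w := if b then word_inv (P l) else P l.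
pose Q i := if i == k then P k ++ w else P i.
have [|S SQ SB] := IH Q.
  apply/matrixP => i j; rewrite !mxE /Q; case: eqP => [->|_]; last by rewrite -eA mxE.
  rewrite exponent_sum_cat -eA !mxE /w; case: b {IH w Q} => /=.
    by rewrite exponent_sum_inv expr1 mulN1r.
  by rewrite expr0 mul1r.
exists S => //; apply: dominates_trans SQ _; apply: (@dominates_slide _ _ P Q k).
  by move=> i /negbTE ik; rewrite /Q ik.
rewrite /Q eqxx -[X in word_equiv _ _ X]cats0.
apply: word_equiv_cat; first exact: word_equiv_refl.
(* As [l] differs from [k], the relator [P l] survives the removal of the [k]-th one, so the
   appended factor [w] is trivial in the group of the remaining relators. *)
have [j lE|lE] := unliftP k l; last by rewrite lE eqxx in lk.
have Pl : word_equiv (fun i => P (lift k i)) (P l) [::].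
  by rewrite lE; exact: (word_equiv_relator_nil (fun i => P (lift k i)) j).
rewrite /w; case: (b) => //; exact: (word_equiv_inv Pl).
Qed.

End Domination.

Theorem proposition3p3 (R : realType) (n m : nat) (P : presentation n m) :
  exists (ne me : nat) (Pe : presentation ne me)
    (f : continuousType (pres_complex R Pe) (pres_complex R P))
    (f0 : f Cell0 = Cell0)
    (rho : {multiplicative presented_group Pe -> presented_group P}),
    [/\ echelon_presentation Pe,
        (forall g, group_to_pi1 R (rho g) = pi1_map f0 (group_to_pi1 R g)),
        (forall h : presented_group P, exists g, rho g = h),
        (forall h : fundamental_group R (Cell0 : pres_complex R P),
           exists g, pi1_map f0 g = h) &
        forall q : nat, bijective (cohomology_map R f q)].
Proof.
have [B PB BE] := row_reach_echelon (exponent_matrix P).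
have [Q [f [f0 [rho [fE rhoS fS fB]]]] QB] := dominates_row_reach R PB.
by exists n, m, Q, f, f0, rho; split=> //; rewrite /echelon_presentation QB.
Qed.
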